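(* Let $k\in\{12,24,48\}$ and let $E: y^2=x^3+b$ be a Barreto-Lynn-Scott curve of embedding degree $k$ over $\mathbb{F}_p$ with parameter $u\in\mathbb{Z}$. Let $P\in\mathbb{G}_1$ and $Q\in\mathbb{G}_2$ be non-trivial points, let $E_\theta$ be the sextic twist of $E$, with twisting isomorphism $\sigma_\theta$, and let $\widetilde P,\widetilde Q$ be the points of $E_\theta$ with $\sigma_\theta(\widetilde P)=P$ and $\sigma_\theta(\widetilde Q)=Q$. Let $\widetilde W=W_{\widetilde Q,\widetilde P}$ be the elliptic net associated to $E_\theta,\widetilde Q,\widetilde P$. Then the optimal Ate pairing $e_2(Q,P)=f_{u,Q}(P)^{(p^k-1)/r}$ satisfies $$e_2(Q,P)=f_{u,Q}(P)^{\frac{p^k-1}{r}}=\widetilde W(u,1)^{\frac{p^k-1}{r}}.$$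
   Context: Curve families. With integer parameter $u$, the family BLS12 ($k=12$) has $r=u^4-u^2+1$; BLS24 ($k=24$) has $r=u^8-u^4+1$; BLS48 ($k=48$) has $r=u^{16}-u^8+1$. In each case $p=(u-1)^2\,r/3+u$ and $t=u+1$. Here $p>3$ and $r$ are primes, and $E:y^2=x^3+b$ over $\mathbb{F}_p$ has $p+1-t$ rational points over $\mathbb{F}_p$, with $r\mid p+1-t$ and embedding degree $k$ with respect to $r$ (the smallest positive integer with $r\mid p^k-1$). Groups. Let $\pi_p(x,y)=(x^p,y^p)$ be the Frobenius map on $E$. Then $\mathbb{G}_1=E(\overline{\mathbb{F}}_p)[r]\cap\ker(\pi_p-[1])$ and $\mathbb{G}_2=E(\overline{\mathbb{F}}_p)[r]\cap\ker(\pi_p-[p])$. Miller function. For $n\in\mathbb{Z}$, $f_{n,Q}$ is the normalized (leading coefficient $1$ at $\mathcal{O}$) rational function on $E$ with divisor $n(Q)-([n]Q)-(n-1)(\mathcal{O})$. Twist. Put $e=k/6$. Let $\theta\in\mathbb{F}_{p^k}^*$ be such that $\theta^6\in\mathbb{F}_{p^e}$ and $1,\theta,\dots,\theta^5$ is a basis of $\mathbb{F}_{p^k}$ over $\mathbb{F}_{p^e}$. The twist is $E_\theta:y^2=x^3+b\theta^{-6}$ over $\mathbb{F}_{p^e}$, with isomorphism $\sigma_\theta:E_\theta\to E$, $(x,y)\mapsto(x\theta^2,y\theta^3)$ (defined over $\mathbb{F}_{p^k}$). The twist is the one for which the point $\widetilde Q$ corresponding to $Q\in\mathbb{G}_2$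 lies in $E_\theta(\mathbb{F}_{p^e})$. Elliptic nets. An elliptic net is a map $W$ from a finitely generated free abelian group $\mathcal A$ to an integral domain such that for all $p,q,r,s\in\mathcal A$, $$W(p+q+s)W(p-q)W(r+s)W(r)+W(q+r+s)W(q-r)W(p+s)W(p)+W(r+p+s)W(r-p)W(q+s)W(q)=0.$$ For a curve $y^2=x^3+Ax+B$ and points $S=(x_1,y_1)$, $R=(x_2,y_2)$ on it with $S,R,S+R,S-R\neq\mathcal O$, the elliptic net $W_{S,R}:\mathbb{Z}^2\to\mathbb{K}$ associated to the curve and $S,R$ (in this order) is Stange's net, i.e. the elliptic net with $W(0,0)=0$, $W(-v)=-W(v)$ and initial values $W(1,0)=W(0,1)=W(1,1)=1$, $W(2,0)=2y_1$, $W(3,0)=3x_1^4+6Ax_1^2+12Bx_1-A^2$, $W(4,0)=4y_1(x_1^6+5Ax_1^4+20Bx_1^3-5A^2x_1^2-4ABx_1-8B^2-A^3)$, $W(2,1)=2x_1+x_2-\left(\frac{y_2-y_1}{x_2-x_1}\right)^2$, $W(-1,1)=x_1-x_2$, $W(2,-1)=(y_1+y_2)^2-(2x_1+x_2)(x_1-x_2)^2$. (Over $\mathbb{C}$, $W_{S,R}(v_1,v_2)=\sigma(v_1z_1+v_2z_2)\,\sigma(z_1)^{-(v_1^2-v_1v_2)}\sigma(z_1+z_2)^{-v_1v_2}\sigma(z_2)^{-(v_2^2-v_1v_2)}$, where $\sigma$ is the Weierstrass sigma function and $z_1,z_2$ correspond to $S,R$.) *)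

(* Defs.v *)
From HB Require Import structures.
From mathcomp Require Import all_boot all_order all_algebra all_field.
From mathcomp Require Import boolp classical_sets.

Set Implicit Arguments.
Unset Strict Implicit.
Unset Printing Implicit Defensive.

Import GRing.Theory.
Local Open Scope ring_scope.

(** * Short Weierstrass curves and the chord-and-tangent law *)

(* The curve y^2 = x^3 + wA x + wB. *)
Record weierstrass (F : Type) := Weierstrass { wA : F; wB : F }.

(* [None] is the point at infinity O, [Some (x, y)] an affine point. *)
Notation ecpoint F := (option (F * F)%type).

Definition nonsingular (F : fieldType) (E : weierstrass F) : Prop :=
  4 * wA E ^+ 3 + 27 * wB E ^+ 2 != 0.

Definition on_curve (F : fieldType) (E : weierstrass F) (T : ecpoint F) : bool :=
  if T is Some (x, y) then y ^+ 2 == x ^+ 3 + wA E * x + wB E else true.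

Definition ec_opp (F : fieldType) (T : ecpoint F) : ecpoint F :=
  if T is Some (x, y) then Some (x, - y) else None.

Definition ec_add (F : fieldType) (E : weierstrass F) (S T : ecpoint F) :
    ecpoint F :=
  match S, T with
  | None, _ => T
  | _, None => S
  | Some (x1, y1), Some (x2, y2) =>
      if (x1 == x2) && (y1 == - y2) then None else
      let l := if x1 == x2 then (3 * x1 ^+ 2 + wA E) / (2 * y1)
               else (y2 - y1) / (x2 - x1) in
      let x3 := l ^+ 2 - x1 - x2 in
      Some (x3, l * (x1 - x3) - y1)
  end.

Definition ec_mul (F : fieldType) (E : weierstrass F) (n : int)
    (T : ecpoint F) : ecpoint F :=
  match n with
  | Posz m => iter m (ec_add E T) None
  | Negz m => ec_opp (iter m.+1 (ec_add E T) None)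
  end.

(** * The function field *)

(* Y^2 - (X^3 + wA X + wB), as a polynomial in Y over F(X). *)
Definition curve_poly (F : fieldType) (E : weierstrass F) :
    {poly {fraction {poly F}}} :=
  'X^2 - (tofrac ('X^3 + wA E *: 'X + (wB E)%:P))%:P.

Lemma fracE (R : idomainType) (z : {fraction R}) :
  exists n d : R, d != 0 /\ z * tofrac d = tofrac n.
Proof.
elim/quotW: z => z; exists \n_z, \d_z; split; first exact: denom_ratioP.
unlock tofrac.
rewrite -[LHS]FracField.pi_mul /FracField.mulf /= !numden_Ratio ?oner_eq0 //.
rewrite mulr1; apply/eqmodP => /=.
rewrite FracField.equivfE !numden_Ratio ?oner_eq0 ?denom_ratioP //.
by rewrite mulr1 mulrC.
Qed.

Lemma curve_poly_irr (F : fieldType) (E : weierstrass F) :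
  monic_irreducible_poly (curve_poly E).
Proof.
rewrite /curve_poly; set f : {poly F} := 'X^3 + _ + _.
have sz_f : size f = 4.
  rewrite /f -addrA size_polyDl size_polyXn //.
  rewrite (leq_ltn_trans (size_polyD _ _)) // gtn_max.
  rewrite (leq_ltn_trans (size_scale_leq _ _)) ?size_polyX //=.
  by rewrite (leq_ltn_trans (size_polyC_leq1 _)).
have sz_h : size ('X^2 - (tofrac f)%:P : {poly {fraction {poly F}}}) = 3.
  rewrite size_polyDl size_polyXn // size_polyN.
  by rewrite (leq_ltn_trans (size_polyC_leq1 _)).
split; last first.
  by rewrite monicE lead_coefE sz_h coefB coefXn coefC /= subr0.
apply: cubic_irreducible; rewrite ?sz_h // => z; apply/negP.
rewrite /root !hornerE /= subr_eq0 => /eqP zz.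
have [n [d [nz_d zd]]] := fracE z.
have eq_nd : n ^+ 2 = f * d ^+ 2.
  apply/eqP; rewrite -tofrac_eq !(rmorphXn, rmorphM) /= -zd exprMn.
  by rewrite ?expr2 in zz *; rewrite zz ?expr2.
have nz_f : f != 0 by rewrite -size_poly_eq0 sz_f.
have nz_n : n != 0.
  have: n ^+ 2 != 0 by rewrite eq_nd mulf_neq0 ?expf_neq0.
  by rewrite expf_eq0.
have : odd (size (n * n)) = odd (size (f * (d * d))) by rewrite -!expr2 eq_nd.
rewrite (size_mul nz_f) ?mulf_neq0 // sz_f !size_mul //.
move: nz_n nz_d; rewrite -!size_poly_gt0.
case: (size n) => // a _; case: (size d) => // c _.
by rewrite !(addnS, addSn, add0n) /= !addnn !odd_double.
Qed.

(* F(E) = F(X)[Y] / (Y^2 - (X^3 + wA X + wB)). *)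
Definition funfield (F : fieldType) (E : weierstrass F) : fieldType :=
  {poly %/ curve_poly E with curve_poly_irr E}.

Definition fconst (F : fieldType) (E : weierstrass F) (c : F) : funfield E :=
  qpolyC (curve_poly E) (tofrac c%:P).

Definition fx (F : fieldType) (E : weierstrass F) : funfield E :=
  qpolyC (curve_poly E) (tofrac 'X).

Definition fy (F : fieldType) (E : weierstrass F) : funfield E :=
  qpolyX (curve_poly E).

(* Local affine coordinates: (x, y) at an affine point, and (x/y, 1/y) at O,
   where O = (0 : 1 : 0) has coordinates (0, 0). *)
Definition chart (F : fieldType) (E : weierstrass F) (T : ecpoint F) :
    funfield E * funfield E :=
  if T is Some _ then (fx E, fy E) else (fx E / fy E, (fy E)^-1).

Definition chart_coord (F : fieldType) (T : ecpoint F) : F * F :=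
  if T is Some xy then xy else (0, 0).

Definition lift2 (F : fieldType) (E : weierstrass F) (G : {poly {poly F}}) :
    {poly {poly funfield E}} :=
  map_poly (map_poly (fconst E)) G.

(* The rational function f is regular at the point T of E, with value v. *)
Definition has_value (F : fieldType) (E : weierstrass F) (f : funfield E)
    (T : ecpoint F) (v : F) : Prop :=
  let: (s, t) := chart_coord T in
  let: (sE, tE) := chart E T in
  exists G H : {poly {poly F}},
    [/\ H.[s, t] != 0, v = G.[s, t] / H.[s, t] &
        f = (lift2 E G).[sE, tE] / (lift2 E H).[sE, tE]].

(* Junk value 0 at the points where f is not regular. *)
Definition fun_eval (F : fieldType) (E : weierstrass F) (f : funfield E)
    (T : ecpoint F) : F :=
  xget 0 (has_value f T).

(* A local parameter at each point of a nonsingular curve (in odd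
   characteristic); at O it is x/y. *)
Definition uniformizer (F : fieldType) (E : weierstrass F) (T : ecpoint F) :
    funfield E :=
  match T with
  | None => fx E / fy E
  | Some (x0, y0) => if y0 == 0 then fy E else fx E - fconst E x0
  end.

(* f has order n at T, and leading coefficient c with respect to the
   uniformizer chosen above. *)
Definition has_leading_term (F : fieldType) (E : weierstrass F)
    (f : funfield E) (T : ecpoint F) (n : int) (c : F) : Prop :=
  c != 0 /\ exists2 g : funfield E,
    has_value g T c & f = uniformizer E T ^ n * g.

(* To be used over an algebraically closed F, where the places of F(E) are the
   F-points of E. *)
Definition has_divisor (F : fieldType) (E : weierstrass F) (f : funfield E)
    (D : ecpoint F -> int) : Prop :=
  forall T, on_curve E T -> exists c, has_leading_term f T (D T) c.

Definition normalized (F : fieldType) (E : weierstrass F) (f : funfield E) :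
    Prop :=
  exists n, has_leading_term f None n 1.

(* n(Q) - ([n]Q) - (n-1)(O) *)
Definition miller_divisor (F : fieldType) (E : weierstrass F) (n : int)
    (Q : ecpoint F) (T : ecpoint F) : int :=
  n * (T == Q)%:Z - (T == ec_mul E n Q)%:Z - (n - 1) * (T == None)%:Z.

Definition is_miller (F : fieldType) (E : weierstrass F) (n : int)
    (Q : ecpoint F) (f : funfield E) : Prop :=
  has_divisor f (miller_divisor E n Q) /\ normalized f.

(* f_{n,Q} *)
Definition miller (F : fieldType) (E : weierstrass F) (n : int)
    (Q : ecpoint F) : funfield E :=
  xget 0 (is_miller n Q).

(** * Frobenius and the pairing groups *)

Definition in_Fq (F : fieldType) (q : nat) (x : F) : Prop := x ^+ q = x.

Definition rational_point (F : fieldType) (q : nat) (T : ecpoint F) : Prop :=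
  if T is Some (x, y) then in_Fq q x /\ in_Fq q y else True.

Definition frob (F : fieldType) (p : nat) (T : ecpoint F) : ecpoint F :=
  if T is Some (x, y) then Some (x ^+ p, y ^+ p) else None.

(* T \in E[r] \cap ker (pi_p - [m]); F is an algebraic closure of F_p. *)
Definition frob_eigen (F : fieldType) (E : weierstrass F) (p r : nat) (m : int)
    (T : ecpoint F) : Prop :=
  [/\ on_curve E T, ec_mul E r T = None &
      ec_add E (frob p T) (ec_opp (ec_mul E m T)) = None].

Definition in_G1 (F : fieldType) (E : weierstrass F) (p r : nat)
    (T : ecpoint F) : Prop := frob_eigen E p r 1 T.

Definition in_G2 (F : fieldType) (E : weierstrass F) (p r : nat)
    (T : ecpoint F) : Prop := frob_eigen E p r p T.

Definition optimal_ate (F : fieldType) (E : weierstrass F) (p r k : nat)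
    (u : int) (Q P : ecpoint F) : F :=
  fun_eval (miller E u Q) P ^+ ((p ^ k - 1) %/ r)%N.

(** * Barreto-Lynn-Scott curves *)

Definition embedding_degree (p r k : nat) : Prop :=
  [/\ (0 < k)%N, (r %| p ^ k - 1)%N &
      forall j : nat, (0 < j < k)%N -> ~~ (r %| p ^ j - 1)%N].

Definition bls_r (k : nat) (u : int) : int :=
  match k with
  | 12 => u ^+ 4 - u ^+ 2 + 1
  | 24 => u ^+ 8 - u ^+ 4 + 1
  | 48 => u ^+ 16 - u ^+ 8 + 1
  | _ => 0
  end.

Definition bls_t (u : int) : int := u + 1.

Record is_BLS (k : nat) (u : int) (p r : nat) (b : 'F_p) : Prop := IsBLS {
  bls_k : k \in [:: 12; 24; 48];
  bls_p_prime : prime p;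
  bls_p_gt3 : (3 < p)%N;
  bls_r_prime : prime r;
  bls_rE : r%:Z = bls_r k u;
  (* p = (u - 1)^2 r / 3 + u *)
  bls_pE : 3 * (p%:Z - u) = (u - 1) ^+ 2 * r%:Z;
  bls_nonsingular : nonsingular (Weierstrass 0 b);
  bls_card : #|[pred T : ecpoint 'F_p | on_curve (Weierstrass 0 b) T]|%:Z
             = p%:Z + 1 - bls_t u;
  bls_r_dvd : (r%:Z %| p%:Z + 1 - bls_t u)%Z;
  bls_embedding : embedding_degree p r k
}.

(** * Sextic twists *)

Definition twist_curve (F : fieldType) (b theta : F) : weierstrass F :=
  Weierstrass 0 (b * theta ^- 6).

Definition twist_map (F : fieldType) (theta : F) (T : ecpoint F) : ecpoint F :=
  if T is Some (x, y) then Some (x * theta ^+ 2, y * theta ^+ 3) else None.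

(* F is an algebraic closure of F_p, in which the subfield with p^n elements is
   [in_Fq (p ^ n)]. *)
Record is_sextic_twist (F : fieldType) (b : F) (p r k : nat) (theta : F) :
    Prop := IsSexticTwist {
  twist_neq0 : theta != 0;
  twist_Fpk : in_Fq (p ^ k) theta;
  twist_exp6 : in_Fq (p ^ (k %/ 6)) (theta ^+ 6);
  twist_basis : forall x : F, in_Fq (p ^ k) x ->
    exists! c : 'rV[F]_6,
      (forall i, in_Fq (p ^ (k %/ 6)) (c 0 i)) /\
      x = \sum_(i < 6) c 0 i * theta ^+ i;
  twist_rational : forall T : ecpoint F,
    on_curve (twist_curve b theta) T ->
    in_G2 (Weierstrass 0 b) p r (twist_map theta T) ->
    rational_point (p ^ (k %/ 6)) T
}.

(** * Elliptic nets *)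

Definition is_elliptic_net (A : zmodType) (R : idomainType) (W : A -> R) :
    Prop :=
  forall p q r s : A,
    W (p + q + s) * W (p - q) * W (r + s) * W r
    + W (q + r + s) * W (q - r) * W (p + s) * W p
    + W (r + p + s) * W (r - p) * W (q + s) * W q = 0.

(* W = W_{S,R}, for S, R, S + R and S - R different from O. *)
Definition is_net_of (F : fieldType) (E : weierstrass F) (S R : ecpoint F)
    (W : int * int -> F) : Prop :=
  let A := wA E in let B := wB E in
  match S, R with
  | Some (x1, y1), Some (x2, y2) =>
      [/\ is_elliptic_net W, W (0, 0) = 0 & forall v, W (- v) = - W v] /\
      [/\ W (1, 0) = 1, W (0, 1) = 1 & W (1, 1) = 1] /\
      [/\ W (2, 0) = 2 * y1,
          W (3, 0) = 3 * x1 ^+ 4 + 6 * A * x1 ^+ 2 + 12 * B * x1 - A ^+ 2 &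
          W (4, 0) = 4 * y1 *
            (x1 ^+ 6 + 5 * A * x1 ^+ 4 + 20 * B * x1 ^+ 3
             - 5 * A ^+ 2 * x1 ^+ 2 - 4 * A * B * x1 - 8 * B ^+ 2 - A ^+ 3)] /\
      [/\ W (2, 1) = 2 * x1 + x2 - ((y2 - y1) / (x2 - x1)) ^+ 2,
          W (-1, 1) = x1 - x2 &
          W (2, -1) = (y1 + y2) ^+ 2 - (2 * x1 + x2) * (x1 - x2) ^+ 2]
  | _, _ => False
  end.

(* Main.v *)
Require Import Defs.
From HB Require Import structures.
From mathcomp Require Import all_boot all_order all_algebra all_field.
From mathcomp Require Import boolp classical_sets.
From mathcomp Require Import ring zify.

Set Implicit Arguments.
Unset Strict Implicit.
Unset Printing Implicit Defensive.

Import Order.TTheory GRing.Theory Num.Theory.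
Local Open Scope ring_scope.

(** Modulo the factors killed by the final exponentiation, f_{u,Q}(P) and
    the net value at (u,1) are the same product, or its inverse if u < 0: the
    product of the values at P of the chords through Q and [i]Q, for 0 < i < |u|.

    On the side of functions, the quotients (chord through Q and [i]Q) /
    (vertical through [i+1]Q) have divisors (Q) + ([i]Q) - ([i+1]Q) - (O), which
    telescope: their product over 0 < i < n is a normalized function with the
    divisor of f_{n,Q} ([miller_fun_principal]), and f_{-n,Q} is the inverse of
    f_{n,Q} times the vertical through [n]Q.  These are the Miller functions
    because a divisor and a leading coefficient determine a function
    ([principal_normalized_inj]): a function regular at all affine points is
    a polynomial in x and y ([regular_affine_polynomial]), and such
    a polynomial has a pole at O unless it is constant ([leading_polynomial]).

    On the side of nets, put psi_n = W(n,0) and phi_n = W(n,1) for the twist and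
    the points Q~, P~.  The net relations give, first,
      x_Q - x_{[n]Q} = psi_{n+1} psi_{n-1} / psi_n^2     ([psi_neq0_x])
    and then, by means of it,
      phi_{n+1} / phi_n = (psi_{n+1} / psi_n) L_n / ((x_P - x_Q) (x_P - x_{[n]Q}))
    where L_n is the value at P of the chord through Q and [n]Q ([phi_step]).
    A negative index is reached through
      phi_n phi_{-n} = - psi_n^2 (x_P - x_{[n]Q})        ([phi_neg_mul]).

    Put q = p^(k/6) and N = (p^k - 1)/r.  Since p is odd and r is an odd prime
    that divides q^3 + 1, N is a multiple of 2 (q^3 - 1), which is a multiple of
    6 (q - 1) because q = 1 modulo 3 ([bls_final_exponent]).  So z^N = 1 for z
    in F_{q^3}^*, and theta^N = 1 because theta^6 is in F_q.  The point Q~ is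
    F_q-rational, which makes each psi_n a product of powers of elements of F_q^*;
    and theta^2 (x_P~ - x_{[n]Q~}) lies in F_{q^3}, because x_P is in F_p and
    theta^2 in F_{q^3}.  Only the chords survive, and the chords of E and of the
    twist differ by theta^3.

    Nothing degenerates: |u| + 2 < r and r is prime, so [i]Q is never O and
    never +-Q in the range needed, and x_P~ = x_{[i]Q~} would put theta^2
    or theta^3 into F_q. *)

(** * The coordinate ring of a Weierstrass curve *)

Section CoordinateRing.
Variables (F : fieldType) (E : weierstrass F).

Definition cubic : {poly F} := 'X^3 + wA E *: 'X + (wB E)%:P.

Lemma size_cubic : size cubic = 4.
Proof.
rewrite /cubic -addrA size_polyDl size_polyXn //.
rewrite (leq_ltn_trans (size_polyD _ _)) // gtn_max.
rewrite (leq_ltn_trans (size_scale_leq _ _)) ?size_polyX //=.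
by rewrite (leq_ltn_trans (size_polyC_leq1 _)).
Qed.

Lemma cubic_horner x0 : cubic.[x0] = x0 ^+ 3 + wA E * x0 + wB E.
Proof. by rewrite /cubic !hornerE. Qed.

Lemma poly2_ind (P : {poly {poly F}} -> Prop) :
  (forall c, P c%:P%:P) -> (forall G H, P G -> P H -> P (G * 'X + H)) ->
  (forall G c, P G%:P -> P (G * 'X + c%:P)%:P) -> forall G, P G.
Proof.
move=> PC PX PY; elim/poly_ind => [|G C PG]; first exact: (PC 0).
apply: PX => //; elim/poly_ind: C => [|C c PC']; first exact: (PC 0).
exact: PY.
Qed.

(** The function field enters through the three properties that characterize
    it: y^2 is the cubic in x, the functions 1 and y are independent over F[x],
    and they generate L over F(x). *)
Variables (L : fieldType) (pf : {rmorphism {poly F} -> L}) (y : L).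
Hypothesis y_sqr : y ^+ 2 = pf cubic.
Hypothesis pf_indep : forall a b, pf a + pf b * y = 0 -> a = 0 /\ b = 0.
Hypothesis pf_generate : forall h, exists m n1 n2,
  m != 0 /\ h * pf m = pf n1 + pf n2 * y.

Let x := pf 'X.
Let c (a : F) : L := pf a%:P.

Lemma pf_eq0 a : (pf a == 0) = (a == 0).
Proof.
apply/eqP/eqP => [h|->]; last by rewrite rmorph0.
by have [] := @pf_indep a 0; rewrite ?rmorph0 ?mul0r ?addr0.
Qed.

Lemma x_neq0 : x != 0. Proof. by rewrite pf_eq0 polyX_eq0. Qed.

Lemma y_neq0 : y != 0.
Proof.
have : y ^+ 2 != 0 by rewrite y_sqr pf_eq0 -size_poly_eq0 size_cubic.
by rewrite expf_eq0.
Qed.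

Lemma pfE a b : pf (a * 'X + b%:P) = pf a * x + c b.
Proof. by rewrite rmorphD rmorphM. Qed.

Definition ev_fun (st : L * L) (G : {poly {poly F}}) : L :=
  (map_poly (map_poly c) G).[st.1, st.2].

Lemma ev_fun_is_ev st G : ev_fun st G = (map_poly (map_poly (pf \o polyC)) G).[st.1, st.2].
Proof. by []. Qed.

Lemma ev_funD st G H : ev_fun st (G + H) = ev_fun st G + ev_fun st H.
Proof. by rewrite !ev_fun_is_ev rmorphD !hornerD. Qed.
Lemma ev_funM st G H : ev_fun st (G * H) = ev_fun st G * ev_fun st H.
Proof. by rewrite !ev_fun_is_ev rmorphM !hornerM. Qed.
Lemma ev_funX st : ev_fun st 'X = st.1.
Proof. by rewrite ev_fun_is_ev map_polyX hornerX hornerC. Qed.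
Lemma ev_funY st : ev_fun st 'X%:P = st.2.
Proof. by rewrite ev_fun_is_ev map_polyC /= map_polyX hornerC hornerX. Qed.
Lemma ev_funC st a : ev_fun st a%:P%:P = c a.
Proof. by rewrite ev_fun_is_ev map_polyC /= map_polyC !hornerC. Qed.

Definition ev_pt (st : F * F) (G : {poly {poly F}}) : F := G.[st.1, st.2].
Lemma ev_ptD st G H : ev_pt st (G + H) = ev_pt st G + ev_pt st H.
Proof. by rewrite /ev_pt !hornerD. Qed.
Lemma ev_ptM st G H : ev_pt st (G * H) = ev_pt st G * ev_pt st H.
Proof. by rewrite /ev_pt !hornerM. Qed.
Lemma ev_ptX st : ev_pt st 'X = st.1.
Proof. by rewrite /ev_pt hornerX hornerC. Qed.
Lemma ev_ptY st : ev_pt st 'X%:P = st.2.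
Proof. by rewrite /ev_pt hornerC hornerX. Qed.
Lemma ev_ptC st a : ev_pt st a%:P%:P = a.
Proof. by rewrite /ev_pt !hornerC. Qed.

(** Reduction modulo y^2 - cubic to the form a(x) + b(x) y, which does not
    change values at the points of the curve. *)
Lemma ev_fun_affine G : exists a b : {poly F},
  ev_fun (x, y) G = pf a + pf b * y /\
  forall x0 y0, y0 ^+ 2 = cubic.[x0] -> ev_pt (x0, y0) G = a.[x0] + b.[x0] * y0.
Proof.
elim/poly2_ind: G => [k|G H [a [b [e1 e2]]] [a' [b' [e1' e2']]]|G k [a [b [e1 e2]]]].
- exists k%:P, 0; split=> [|x0 y0 _].
    by rewrite ev_funC rmorph0 mul0r addr0.
  by rewrite ev_ptC hornerC horner0 mul0r addr0.
- exists (a * 'X + a'), (b * 'X + b'); split=> [|x0 y0 h].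
    by rewrite ev_funD ev_funM e1 e1' ev_funX !rmorphD !rmorphM -/x /=; ring.
  by rewrite ev_ptD ev_ptM (e2 _ _ h) (e2' _ _ h) ev_ptX !hornerE /=; ring.
exists (b * cubic + k%:P), a; split=> [|x0 y0 h].
  rewrite polyCD polyCM ev_funD ev_funM e1 ev_funY ev_funC rmorphD rmorphM -y_sqr -/(c k) /=.
  by ring.
rewrite polyCD polyCM ev_ptD ev_ptM (e2 _ _ h) ev_ptY ev_ptC.
by rewrite !hornerD !hornerM hornerC -h /=; ring.
Qed.

Lemma ev_fun_affine_neq0 G x0 y0 : y0 ^+ 2 = cubic.[x0] ->
  ev_pt (x0, y0) G != 0 -> ev_fun (x, y) G != 0.
Proof.
have [a [b [-> e]]] := ev_fun_affine G => /e->; apply: contra_neq => h.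
by have [-> ->] := pf_indep h; rewrite !horner0 mul0r addr0.
Qed.

(** * Pole orders at infinity *)

(** The functions a(x) + b(x) y whose pole at O has order at most w, counting
    2 for x and 3 for y: the bounds say 2 deg a <= w and 2 deg b + 3 <= w, in
    a form that also covers zero polynomials. *)
Definition pole_bound w h := exists a b,
  [/\ h = pf a + pf b * y, (2 * size a <= w + 2)%N & (2 * size b <= w.-1)%N].

Lemma pole_bound_weaken w w' h : (w <= w')%N -> pole_bound w h -> pole_bound w' h.
Proof. by move=> ww' [a [b [-> ha hb]]]; exists a, b; split=> //; lia. Qed.

Lemma pole_boundD w h h' : pole_bound w h -> pole_bound w h' -> pole_bound w (h + h').
Proof.
move=> [a [b [-> ha hb]]] [a' [b' [-> ha' hb']]]; exists (a + a'), (b + b').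
split; first by rewrite !rmorphD /=; ring.
  by apply: leq_trans (leq_mul (leqnn 2) (size_polyD _ _)) _; lia.
by apply: leq_trans (leq_mul (leqnn 2) (size_polyD _ _)) _; lia.
Qed.

Lemma pole_boundZ w k h : pole_bound w h -> pole_bound w (c k * h).
Proof.
move=> [a [b [-> ha hb]]]; exists (k *: a), (k *: b).
rewrite -!mul_polyC !rmorphM -/(c k) !mul_polyC.
split; first by ring.
  by apply: leq_trans (leq_mul (leqnn 2) (size_scale_leq _ _)) _.
by apply: leq_trans (leq_mul (leqnn 2) (size_scale_leq _ _)) _.
Qed.

Lemma pole_bound_x w h : pole_bound w h -> pole_bound (w + 2) (x * h).
Proof.
move=> [a [b [-> ha hb]]]; exists ('X * a), ('X * b); split.
- by rewrite !rmorphM -/x /=; ring.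
- have [->|a0] := eqVneq a 0; first by rewrite mulr0 size_poly0.
  by rewrite mulrC size_mulX //; lia.
have [->|b0] := eqVneq b 0; first by rewrite mulr0 size_poly0.
by rewrite mulrC size_mulX //; move: b0; rewrite -size_poly_gt0; lia.
Qed.

Lemma pole_bound_y w h : pole_bound w h -> pole_bound (w + 3) (y * h).
Proof.
move=> [a [b [-> ha hb]]]; exists (b * cubic), a; split; last by lia.
  by rewrite rmorphM -y_sqr /=; ring.
have [->|] := eqVneq b 0; first by rewrite mul0r size_poly0.
rewrite -size_poly_gt0 => b0.
by apply: leq_trans (leq_mul (leqnn 2) (size_polyMleq _ _)) _; rewrite size_cubic; lia.
Qed.

Lemma pole_bound_yn d : pole_bound (3 * d) (y ^+ d).
Proof.
elim: d => [|d IH]; last by rewrite exprS; apply: pole_bound_weaken (pole_bound_y IH); lia.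
by exists 1, 0; rewrite rmorph1 rmorph0 mul0r addr0 size_poly1 size_poly0.
Qed.

(** In y^(2m) = cubic^m nothing cancels, so that the order 6m is attained. *)
Lemma pole_bound_yn_even m : (0 < m)%N -> ~ pole_bound (6 * m).-1 (y ^+ (2 * m)).
Proof.
move=> m0 [a [b [h ha hb]]].
have [e _] : cubic ^+ m - a = 0 /\ - b = 0.
  by apply: pf_indep; rewrite rmorphB rmorphN rmorphXn -y_sqr -exprM h; ring.
have : (size (cubic ^+ m)).-1 = (3 * m)%N.
  by rewrite size_exp size_cubic.
by rewrite (subr0_eq e); lia.
Qed.

(** In G(x/y, 1/y) y^d each term but the constant one has a pole of order less
    than 3d: x/y has weight -1 and 1/y has weight -3. *)
Lemma ev_fun_infinity G : exists M, forall d, (M <= d)%N -> (0 < d)%N ->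
  pole_bound (3 * d).-1 (y ^+ d * ev_fun (x / y, y^-1) G - c (ev_pt (0, 0) G) * y ^+ d).
Proof.
(* The induction hypothesis bounds a difference by 3d - 1; here c k * y^d is put back. *)
have strong a k d : pole_bound (3 * d).-1 (y ^+ d * a - c k * y ^+ d) ->
    pole_bound (3 * d) (y ^+ d * a).
  move=> h; rewrite -[y ^+ d * a](subrK (c k * y ^+ d)).
  by apply: pole_boundD; [apply: pole_bound_weaken h; lia | apply/pole_boundZ/pole_bound_yn].
have zero w : pole_bound w 0.
  by exists 0, 0; rewrite rmorph0 mul0r addr0 size_poly0.
elim/poly2_ind: G => [k|G H [M hM] [M' hM']|G k [M hM]].
- exists 0%N => d _ _; rewrite ev_funC ev_ptC mulrC subrr; exact: zero.
- exists (M + M').+2 => -[//|d] hd _; rewrite ev_funD ev_funM ev_ptD ev_ptM ev_funX ev_ptX /= mulr0 add0r.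
  have -> : y ^+ d.+1 * (ev_fun (x / y, y^-1) G * (x / y) + ev_fun (x / y, y^-1) H)
      - c (ev_pt (0, 0) H) * y ^+ d.+1 =
    x * (y ^+ d * ev_fun (x / y, y^-1) G) +
    (y ^+ d.+1 * ev_fun (x / y, y^-1) H - c (ev_pt (0, 0) H) * y ^+ d.+1).
    by rewrite exprS; field; exact: y_neq0.
  apply: pole_boundD; last by apply: hM'; lia.
  by apply: pole_bound_weaken (pole_bound_x (strong _ _ _ (hM d _ _))); lia.
exists M.+2 => -[//|d] hd _; rewrite polyCD polyCM ev_funD ev_funM ev_ptD ev_ptM ev_funY ev_funC ev_ptY ev_ptC /=.
rewrite mulr0 add0r.
have -> : y ^+ d.+1 * (ev_fun (x / y, y^-1) G%:P * y^-1 + c k) - c k * y ^+ d.+1 =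
  y ^+ d * ev_fun (x / y, y^-1) G%:P.
  by rewrite exprS; field; exact: y_neq0.
by apply: pole_bound_weaken (strong _ _ _ (hM d _ _)); lia.
Qed.

(** Otherwise y^d, for a large even d, would have a pole of order below 3d. *)
Lemma ev_fun_infinity_neq0 G : ev_pt (0, 0) G != 0 -> ev_fun (x / y, y^-1) G != 0.
Proof.
set g := ev_pt _ G => g0; apply/eqP => GL; have [M hM] := ev_fun_infinity G.
apply: (@pole_bound_yn_even M.+1) => //.
have -> : y ^+ (2 * M.+1) = c (- g^-1) * (0 - c g * y ^+ (2 * M.+1)).
  rewrite sub0r mulrN mulrA -[c _ * c _]rmorphM -polyCM mulNr mulVf // polyCN.
  by rewrite rmorphN rmorph1 mulN1r opprK.
apply: pole_boundZ; rewrite -[X in X - _](mulr0 (y ^+ (2 * M.+1))) -GL.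
by apply: pole_bound_weaken (hM _ _ _); lia.
Qed.

(** * Values of functions at points *)

Definition chart_fun (T : ecpoint F) : L * L :=
  if T is Some _ then (x, y) else (x / y, y^-1).

(** The relation [has_value] of the function field, in terms of [pf] and [y]. *)
Definition regular_value (f : L) (T : ecpoint F) (v : F) : Prop :=
  exists G H : {poly {poly F}}, [/\ ev_pt (chart_coord T) H != 0,
    v = ev_pt (chart_coord T) G / ev_pt (chart_coord T) H &
    f = ev_fun (chart_fun T) G / ev_fun (chart_fun T) H].

Local Notation on T := (on_curve E T).

Lemma on_infinity : on None. Proof. by []. Qed.

(** A denominator that does not vanish at T is a nonzero function; this is what
    makes sums of regular functions regular and values unique. *)
Lemma ev_fun_chart_neq0 T H : on T -> ev_pt (chart_coord T) H != 0 ->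
  ev_fun (chart_fun T) H != 0.
Proof.
case: T => [[x0 y0]|_] /=; last exact: ev_fun_infinity_neq0.
by rewrite -cubic_horner => /eqP; exact: ev_fun_affine_neq0.
Qed.

Lemma regular_valueD T f g v w : on T -> regular_value f T v ->
  regular_value g T w -> regular_value (f + g) T (v + w).
Proof.
move=> onT [G [H [H0 -> ->]]] [G' [H' [H0' -> ->]]].
have HL := ev_fun_chart_neq0 onT H0; have HL' := ev_fun_chart_neq0 onT H0'.
exists (G * H' + G' * H), (H * H').
rewrite !(ev_ptM, ev_funM, ev_ptD, ev_funD) mulf_neq0 //; split=> //; field.
  by rewrite H0 H0'.
by rewrite HL HL'.
Qed.

Lemma regular_valueM T f g v w : regular_value f T v ->
  regular_value g T w -> regular_value (f * g) T (v * w).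
Proof.
move=> [G [H [H0 -> ->]]] [G' [H' [H0' -> ->]]].
exists (G * G'), (H * H').
by rewrite !(ev_ptM, ev_funM) mulf_neq0 //; split=> //; rewrite mulf_div.
Qed.

Lemma regular_valueV T f v : v != 0 -> regular_value f T v ->
  regular_value f^-1 T v^-1.
Proof.
move=> v0 [G [H [H0 vE ->]]]; exists H, G.
split; last by rewrite invf_div.
  by move: v0; rewrite vE mulf_eq0 negb_or => /andP[].
by rewrite vE invf_div.
Qed.

Lemma regular_valueC T k : regular_value (c k) T k.
Proof.
exists k%:P%:P, 1%:P%:P; rewrite !ev_ptC !ev_funC oner_eq0 divr1.
by rewrite [c 1]rmorph1 divr1.
Qed.

Lemma regular_value0 T : regular_value 0 T 0.
Proof. by have := regular_valueC T 0; rewrite /c !rmorph0. Qed.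

Lemma regular_value1 T : regular_value 1 T 1.
Proof. by have := regular_valueC T 1; rewrite /c !rmorph1. Qed.

Lemma regular_valueN T f v : regular_value f T v -> regular_value (- f) T (- v).
Proof.
move=> h; have := regular_valueM (regular_valueC T (-1)) h.
by rewrite /c polyCN rmorphN rmorph1 !mulN1r.
Qed.

Lemma regular_valueX T f v n : regular_value f T v -> regular_value (f ^+ n) T (v ^+ n).
Proof.
move=> h; elim: n => [|n IH]; first exact: regular_value1.
by rewrite !exprS; apply: regular_valueM.
Qed.

Lemma regular_value_chart1 T : regular_value (chart_fun T).1 T (chart_coord T).1.
Proof.
by exists 'X, 1%:P%:P; rewrite !ev_ptC !ev_funC ev_ptX ev_funX oner_eq0 [c 1]rmorph1 !divr1.
Qed.

Lemma regular_value_chart2 T : regular_value (chart_fun T).2 T (chart_coord T).2.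
Proof.
by exists 'X%:P, 1%:P%:P; rewrite !ev_ptC !ev_funC ev_ptY ev_funY oner_eq0 [c 1]rmorph1 !divr1.
Qed.

Lemma regular_value_pf x0 y0 a : on (Some (x0, y0)) ->
  regular_value (pf a) (Some (x0, y0)) a.[x0].
Proof.
move=> onT; elim/poly_ind: a => [|a k IH].
  by rewrite rmorph0 horner0; apply: regular_value0.
rewrite pfE !hornerE; apply: (regular_valueD onT); last exact: regular_valueC.
by apply: regular_valueM IH _; apply: regular_value_chart1 (Some (x0, y0)).
Qed.

Lemma regular_value_inj T f v w : on T -> regular_value f T v ->
  regular_value f T w -> v = w.
Proof.
move=> onT [G [H [H0 -> ->]]] [G' [H' [H0' -> /eqP]]].
have HL := ev_fun_chart_neq0 onT H0; have HL' := ev_fun_chart_neq0 onT H0'.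
rewrite eqr_div // -!ev_funM -subr_eq0 => /eqP e; apply/eqP; rewrite eqr_div //.
apply: contraTT isT; rewrite -!ev_ptM -subr_eq0 => n0.
have {}n0 : ev_pt (chart_coord T) (G * H' + (-1)%:P%:P * (G' * H)) != 0.
  by rewrite ev_ptD [X in _ + X]ev_ptM ev_ptC mulN1r.
have := ev_fun_chart_neq0 onT n0.
by rewrite ev_funD [X in _ + X]ev_funM ev_funC /c polyCN rmorphN rmorph1 mulN1r e eqxx.
Qed.

(** * Orders and leading coefficients *)

Definition unif (T : ecpoint F) : L :=
  match T with
  | None => x / y
  | Some (x0, y0) => if y0 == 0 then y else x - c x0
  end.

Definition leading (f : L) (T : ecpoint F) (n : int) (k : F) : Prop :=
  k != 0 /\ exists2 g, regular_value g T k & f = unif T ^ n * g.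

Lemma pfXsubC x0 : pf ('X - x0%:P) = x - c x0. Proof. by rewrite rmorphB. Qed.

Lemma unif_neq0 T : unif T != 0.
Proof.
case: T => [[x0 y0]|] /=; last by rewrite mulf_neq0 ?invr_eq0 ?x_neq0 ?y_neq0.
by case: ifP => _; rewrite ?y_neq0 // -pfXsubC pf_eq0 polyXsubC_eq0.
Qed.

Lemma regular_value_unif T : on T -> regular_value (unif T) T 0.
Proof.
case: T => [[x0 y0]|] onT.
  rewrite [unif _]/=; case: ifPn => [/eqP y00|_].
    by rewrite -y00; apply: regular_value_chart2.
  rewrite -[X in regular_value _ _ X](subrr x0).
  apply: regular_valueD onT _ _; first exact: regular_value_chart1.
  exact/regular_valueN/regular_valueC.
exact: regular_value_chart1.
Qed.

Lemma leadingM f g T n m k l : leading f T n k -> leading g T m l ->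
  leading (f * g) T (n + m) (k * l).
Proof.
move=> [k0 [f' hf ->]] [l0 [g' hg ->]]; split; first by rewrite mulf_neq0.
by exists (f' * g'); [apply: regular_valueM | rewrite expfzDr ?unif_neq0 // mulrACA].
Qed.

Lemma leadingV f T n k : leading f T n k -> leading f^-1 T (- n) k^-1.
Proof.
move=> [k0 [f' hf ->]]; split; first by rewrite invr_eq0.
by exists f'^-1; [apply: regular_valueV | rewrite invfM -invr_expz].
Qed.

Lemma leading_regular f T k : k != 0 -> regular_value f T k -> leading f T 0 k.
Proof. by move=> k0 h; split=> //; exists f; rewrite ?expr0z ?mul1r. Qed.

Lemma leadingDl f g T n m k l : on T -> n < m -> leading f T n k ->
  leading g T m l -> leading (f + g) T n k.
Proof.
move=> onT nm [k0 [f' hf ->]] [_ [g' hg ->]]; split=> //.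
have [j mE] : exists j : nat, m = n + j.+1%:Z by exists `|m - n|.-1; lia.
exists (f' + unif T ^+ j.+1 * g').
  rewrite -[X in regular_value _ _ X]addr0 -[X in k + X](mul0r l).
  apply: (regular_valueD onT hf); apply: regular_valueM hg.
  have := regular_valueX j.+1 (regular_value_unif onT).
  by rewrite expr0n.
by rewrite mE expfzDr ?unif_neq0 // mulrDr mulrA.
Qed.

Lemma leading_inj f T n m k l : on T -> leading f T n k -> leading f T m l ->
  n = m /\ k = l.
Proof.
move=> onT; wlog nm : n m k l / n <= m.
  move=> W h h'; have [le|lt] := lerP n m; first exact: W.
  by have [-> ->] := W _ _ _ _ (ltW lt) h' h.
move=> [k0 [f' hf fE]] [l0 [g' hg]]; rewrite fE.
have [j mE] : exists j : nat, m = n + j%:Z by exists `|m - n|%N; lia.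
rewrite mE expfzDr ?unif_neq0 // -mulrA => /(mulfI _) E1.
have {}E1 := E1 (expfz_neq0 _ (unif_neq0 T)).
have hg' : regular_value f' T (0 ^+ j * l).
  by rewrite E1; apply: regular_valueM hg; apply: regular_valueX; apply: regular_value_unif.
have := regular_value_inj onT hf hg'.
case: (j) => [|i]; first by rewrite mul1r addr0.
by rewrite expr0n mul0r => /eqP; rewrite (negPf k0).
Qed.

Lemma y_sqrE : y ^+ 2 = x ^+ 3 + c (wA E) * x + c (wB E).
Proof. by rewrite y_sqr /cubic -mul_polyC !rmorphD rmorphXn rmorphM. Qed.

(** The function (x/y)^3 y = x^3/y^2 is 1 - A (x/y)(1/y) - B (1/y)^2, and this
    unit relates x and y to powers of the uniformizer x/y. *)
Lemma regular_value_weight_unit : regular_value ((x / y) ^+ 3 * y) None 1.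
Proof.
have -> : (x / y) ^+ 3 * y =
    1 - (c (wA E) * ((x / y) * y^-1) + c (wB E) * (y^-1 ^+ 2)).
  have y0 := y_neq0; rewrite -[1](divff (expf_neq0 2 y0)) {1}y_sqrE.
  by field.
have s0 := regular_value_chart1 None; have t0 := regular_value_chart2 None.
have h := regular_valueD _ (regular_valueM (regular_valueC None (wA E)) (regular_valueM s0 t0))
   (regular_valueM (regular_valueC None (wB E)) (regular_valueX 2 t0)).
have := regular_valueD _ (regular_value1 None) (regular_valueN (h isT)).
by rewrite /= !(mulr0, expr0n, addr0, subr0); apply.
Qed.

Lemma leading_x_infinity : leading x None (-2) 1.
Proof.
split; first exact: oner_neq0.
exists ((x / y) ^+ 3 * y); first exact: regular_value_weight_unit.
by rewrite /= -exprnN; field; rewrite x_neq0 y_neq0.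
Qed.

Lemma leading_y_infinity : leading y None (-3) 1.
Proof.
split; first exact: oner_neq0.
exists ((x / y) ^+ 3 * y); first exact: regular_value_weight_unit.
by rewrite /= -exprnN; field; rewrite x_neq0 y_neq0.
Qed.

Lemma leadingC k T : k != 0 -> leading (c k) T 0 k.
Proof. by move=> k0; apply: leading_regular => //; apply: regular_valueC. Qed.

Lemma leading_pf_infinity a : a != 0 ->
  leading (pf a) None (- (2 * (size a).-1)%:Z) (lead_coef a).
Proof.
elim/poly_ind: a => [|a k IH] a0; first by rewrite eqxx in a0.
have [aE|a1] := eqVneq a 0.
  move: a0; rewrite aE mul0r add0r polyC_eq0 => k0.
  by rewrite size_polyC k0 lead_coefC /= muln0; apply: leadingC.
have := leadingM (IH a1) leading_x_infinity.
have -> : - (2 * (size a).-1)%:Z - 2 = - (2 * (size (a * 'X + k%:P)).-1)%:Z.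
  rewrite -cons_poly_def size_cons_poly nil_poly (negPf a1) /=.
  move: a1; rewrite -size_poly_gt0; case: (size a) => // n _ /=; lia.
have -> : lead_coef (a * 'X + k%:P) = lead_coef a * 1.
  rewrite lead_coefDl ?lead_coefMX ?mulr1 // size_mulX // size_polyC.
  by move: a1; rewrite -size_poly_gt0; case: (k == 0) => /=; lia.
have [->|k0] := eqVneq k 0; first by rewrite addr0 rmorphM.
rewrite pfE; have := leadingC None k0 => h2 h1.
apply: leadingDl (isT : on None) _ h1 h2.
rewrite -cons_poly_def size_cons_poly nil_poly (negPf a1) /=.
by move: a1; rewrite -size_poly_gt0; case: (size a) => // n _ /=; lia.
Qed.

(** The orders of a(x) and b(x) y at O have different parities, so that they
    cannot cancel. *)
Lemma leading_polynomial a b : pf a + pf b * y != 0 -> exists n k,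
  [/\ leading (pf a + pf b * y) None n k, n <= 0 & n = 0 -> exists k', pf a + pf b * y = c k'].
Proof.
have [->|b0] := eqVneq b 0.
  rewrite rmorph0 mul0r addr0 pf_eq0 => a0.
  exists (- (2 * (size a).-1)%:Z), (lead_coef a); split; first exact: leading_pf_infinity.
    by lia.
  by move=> n0; exists a`_0; rewrite {1}(@size1_polyC _ a) //; lia.
have hb := leadingM (leading_pf_infinity b0) leading_y_infinity.
have [->|a0] := eqVneq a 0.
  rewrite rmorph0 add0r => _; do 2 eexists; split; first exact: hb.
    by lia.
  by lia.
have ha := leading_pf_infinity a0 => _.
have [lt|le] := ltrP (- (2 * (size a).-1)%:Z) (- (2 * (size b).-1)%:Z - 3).
  by do 2 eexists; split; [exact: leadingDl lt ha hb | lia | lia].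
rewrite addrC; do 2 eexists; split; [apply: leadingDl hb ha => // | lia | lia].
by lia.
Qed.

(** * Functions regular everywhere *)

Lemma regular_affine_repr h x0 y0 v : on (Some (x0, y0)) ->
  regular_value h (Some (x0, y0)) v ->
  exists a b a' b' : {poly F}, a'.[x0] + b'.[x0] * y0 != 0 /\
    h * (pf a' + pf b' * y) = pf a + pf b * y.
Proof.
rewrite /on_curve -cubic_horner => /eqP onT [G [H [H0 _ ->]]].
have [a [b [eG _]]] := ev_fun_affine G; have [a' [b' [eH eH0]]] := ev_fun_affine H.
exists a, b, a', b'; rewrite -eG -eH -(eH0 _ _ onT); split=> //.
by rewrite divfK // (ev_fun_affine_neq0 onT H0).
Qed.

Hypothesis F_closed : forall q : {poly F}, size q != 1 -> exists x, root q x.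
Hypothesis two_neq0 : (2 : F) != 0.

Lemma curve_point x0 : exists y0, on (Some (x0, y0)).
Proof.
have sz : size ('X^2 - cubic.[x0]%:P) = 3.
  rewrite size_polyDl size_polyXn // size_polyN.
  by rewrite (leq_ltn_trans (size_polyC_leq1 _)).
have [|y0] := @F_closed ('X^2 - cubic.[x0]%:P); first by rewrite sz.
rewrite rootE hornerD hornerN hornerXn hornerC subr_eq0 => e.
by exists y0; rewrite /on_curve -cubic_horner.
Qed.

(** Write h m(x) = n1(x) + n2(x) y with m of least degree.  At a root x0 of m,
    regularity at (x0, y0) and (x0, -y0) gives n1(x0) +- n2(x0) y0 = 0.  So x0 is
    a root of n1 and n2 as well, and m is not minimal unless it is constant. *)
Lemma regular_affine_polynomial h :
  (forall T, on T -> T != None -> exists v, regular_value h T v) ->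
  exists a b, h = pf a + pf b * y.
Proof.
move=> reg.
have [m [n1 [n2 [m0 mE]]]] := pf_generate h.
have [n] := ubnP (size m); elim: n m n1 n2 m0 mE => // n IH m n1 n2 m0 mE szm.
have [sz1|sz1] := leqP (size m) 1.
  have mC := size1_polyC sz1; have k0 : m`_0 != 0 by rewrite mC polyC_eq0 in m0.
  exists ((m`_0)^-1 *: n1), ((m`_0)^-1 *: n2).
  have ck0 : c m`_0 != 0 by rewrite pf_eq0 polyC_eq0.
  apply: (mulIf ck0); rewrite {1}/c -mC mE -!mul_polyC !rmorphM /= -/(c _).
  have -> : c (m`_0)^-1 = (c m`_0)^-1.
    by apply: (mulfI ck0); rewrite mulfV // -rmorphM -polyCM mulfV // rmorph1.
  by field.
have [x0 rx0] : exists x0, root m x0 by apply: F_closed; lia.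
have [y0 on1] := curve_point x0.
have on2 : on (Some (x0, - y0)) by rewrite /on_curve sqrrN.
have y0E : y0 ^+ 2 = cubic.[x0] by rewrite cubic_horner; apply/eqP.
(* When y1 = 0 the two points coincide; the coefficient of y gives the second equation. *)
have key y1 : y1 ^+ 2 = cubic.[x0] -> n1.[x0] + n2.[x0] * y1 = 0 /\
      (y1 = 0 -> n2.[x0] = 0).
  move=> y1E; have on1' : on (Some (x0, y1)) by rewrite /on_curve -cubic_horner y1E.
  have [v hv] := reg _ on1' isT.
  have [a [b [a' [b' [v0 e]]]]] := regular_affine_repr on1' hv.
  have : (pf n1 + pf n2 * y) * (pf a' + pf b' * y) = pf m * (pf a + pf b * y).
    by rewrite -e -mE; ring.
  move=> e2; have /pf_indep[/eqP] : pf (n1 * a' + n2 * b' * cubic - m * a) + pf (n1 * b' + n2 * a' - m * b) * y = 0.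
    rewrite !rmorphB !rmorphD !rmorphM /= -y_sqr.
    by apply: etrans (subrr (pf m * (pf a + pf b * y))); rewrite -{1}e2; ring.
  rewrite !subr_eq0 => /eqP e3 /eqP; rewrite subr_eq0 => /eqP e4.
  have := congr1 (horner^~ x0) e3; have := congr1 (horner^~ x0) e4.
  rewrite !hornerD !hornerM (rootP rx0) !mul0r -y1E => e5 e6.
  have e7 : n1.[x0] + n2.[x0] * y1 = 0.
    apply: (mulIf v0); rewrite mul0r.
    transitivity (n1.[x0] * a'.[x0] + n2.[x0] * b'.[x0] * y1 ^+ 2
      + (n1.[x0] * b'.[x0] + n2.[x0] * a'.[x0]) * y1); first by ring.
    by rewrite e5 e6 mul0r addr0.
  split=> // y10; move: v0 e7 e5; rewrite y10 !mulr0 !addr0 => a0 ->.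
  by rewrite mul0r add0r => /eqP; rewrite mulf_eq0 (negPf a0) orbF => /eqP.
have [k1 k1'] := key _ y0E.
have /key[k2 _] : (- y0) ^+ 2 = cubic.[x0] by rewrite sqrrN.
have n10 : n1.[x0] = 0.
  have : 2 * n1.[x0] = 0.
    by rewrite -[RHS](addr0 0) -{1}k1 -k2; ring.
  by move/eqP; rewrite mulf_eq0 (negPf two_neq0) => /eqP.
have n20 : n2.[x0] = 0.
  have [/k1'->//|y00] := eqVneq y0 0.
  by move/eqP: k1; rewrite n10 add0r mulf_eq0 (negPf y00) orbF => /eqP.
have /factor_theorem[m' mE'] := rx0.
have /factor_theorem[n1' n1E] : root n1 x0 by apply/rootP.
have /factor_theorem[n2' n2E] : root n2 x0 by apply/rootP.
have m'0 : m' != 0 by move: m0; rewrite mE' mulf_eq0 => /norP[].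
apply: (IH m' n1' n2' m'0).
  have d0 : pf ('X - x0%:P) != 0 by rewrite pf_eq0 polyXsubC_eq0.
  apply: (mulIf d0); rewrite -mulrA -rmorphM -mE' mE n1E n2E !rmorphM /=.
  by ring.
move: szm; rewrite mE' size_Mmonic ?monicXsubC // size_XsubC.
by lia.
Qed.

Definition principal (f : L) (D : ecpoint F -> int) : Prop :=
  forall T, on T -> exists k, leading f T (D T) k.

(** Such a function is a polynomial in x and y without a pole at O. *)
Lemma principal0_const f : principal f (fun=> 0) -> exists k, f = c k.
Proof.
move=> h; have reg T : on T -> exists2 k, k != 0 & regular_value f T k.
  by move=> /h[k [k0 [g hg ->]]]; exists k; rewrite ?expr0z ?mul1r.
have [|a [b fE]] := @regular_affine_polynomial f.
  by move=> T /reg[k _ hk] _; exists k.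
have [k0 k00 hk0] := reg None isT.
have f0 : pf a + pf b * y != 0.
  rewrite -fE; apply: contra_neq k00 => f0; move: hk0; rewrite f0 => hk0.
  exact: (regular_value_inj on_infinity hk0 (regular_value0 _)).
have [n [k [hl _]]] := leading_polynomial f0.
rewrite -fE in hl *.
have [n0 _] := leading_inj on_infinity hl (leading_regular k00 hk0).
by move=> /(_ n0)[k' ->]; exists k'.
Qed.

Lemma principalM f g D D' : principal f D -> principal g D' ->
  principal (f * g) (fun T => D T + D' T).
Proof.
move=> hf hg T onT; have [k hk] := hf T onT; have [l hl] := hg T onT.
by exists (k * l); apply: leadingM.
Qed.

Lemma principalV f D : principal f D -> principal f^-1 (fun T => - D T).
Proof.
by move=> hf T onT; have [k hk] := hf T onT; exists k^-1; apply: leadingV.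
Qed.

Lemma eq_principal f D D' : D =1 D' -> principal f D -> principal f D'.
Proof. by move=> e h T /h; rewrite e. Qed.

Lemma principal_normalized_inj f g D n m : principal f D -> principal g D ->
  leading f None n 1 -> leading g None m 1 -> f = g.
Proof.
move=> hf hg lf lg.
have [k0 [f0 f1]] := hf None isT; have [l0 [g0 g1]] := hg None isT.
have [k e] : exists k, f * g^-1 = c k.
  apply: principal0_const; apply: eq_principal (principalM hf (principalV hg)).
  by move=> T; rewrite subrr.
have [en _] := leading_inj on_infinity lf (conj f0 f1).
have [em _] := leading_inj on_infinity lg (conj g0 g1).
have := leadingM lf (leadingV lg); rewrite en em subrr invr1 mulr1 e.
case=> _ [h hh]; rewrite expr0z mul1r => kE; rewrite -kE in hh.
have k1 := regular_value_inj on_infinity hh (regular_valueC None k).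
have g_neq0 : g != 0.
  case: g1 => g' hg' ->; rewrite mulf_neq0 ?expfz_neq0 ?unif_neq0 //.
  apply: contra_neq g0 => g'0; move: hg'; rewrite g'0 => hg'.
  exact: (regular_value_inj on_infinity hg' (regular_value0 _)).
move: e; rewrite -k1 /c rmorph1 => /(canRL (divfK g_neq0)).
by rewrite mul1r.
Qed.


(** * Divisors of lines *)

(** The quotient of cubic - cubic(x0) by X - x0; its value at x0 is the
    derivative of the cubic. *)
Definition cubic_quot (x0 : F) : {poly F} :=
  'X^2 + x0%:P * 'X + (x0 ^+ 2 + wA E)%:P.

Lemma cubic_quotE x0 : cubic = cubic_quot x0 * ('X - x0%:P) + cubic.[x0]%:P.
Proof. by rewrite cubic_horner /cubic /cubic_quot -mul_polyC !rmorphD /=; ring. Qed.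

Lemma cubic_quot_neq0 x0 : nonsingular E -> cubic.[x0] = 0 ->
  (cubic_quot x0).[x0] != 0.
Proof.
have -> : (cubic_quot x0).[x0] = 3 * x0 ^+ 2 + wA E.
  by rewrite /cubic_quot !hornerE /=; ring.
rewrite cubic_horner => ns /eqP r0; apply: contra_neq ns => /eqP.
rewrite addrC addr_eq0 => /eqP A; move: r0; rewrite addrC addr_eq0 A => /eqP->.
by ring.
Qed.

(** At a point of order two, x - x0 is the square of the uniformizer y up to
    a unit. *)
Lemma pfXsubC_branch x0 : cubic.[x0] = 0 ->
  pf ('X - x0%:P) = y ^+ 2 / pf (cubic_quot x0).
Proof.
move=> r0; have e := cubic_quotE x0; rewrite r0 addr0 in e.
rewrite y_sqr {1}e rmorphM /= mulrC mulKf // pf_eq0.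
by apply/eqP => q0; have := size_cubic; rewrite e q0 mul0r size_poly0.
Qed.

Lemma leading_pfXsubC x0 y0 x1 : on (Some (x0, y0)) -> y0 != 0 ->
  exists k, leading (pf ('X - x1%:P)) (Some (x0, y0)) (x0 == x1)%:Z k.
Proof.
move=> onT y00; have [<-|x01] := eqVneq x0 x1.
  exists 1; split; first exact: oner_neq0.
  by exists 1; [apply: regular_value1 | rewrite /= (negPf y00) pfXsubC mulr1].
exists (x0 - x1); apply: leading_regular; first by rewrite subr_eq0.
by have := regular_value_pf ('X - x1%:P) onT; rewrite !hornerE.
Qed.

Lemma leading_vertical_infinity x1 : leading (pf ('X - x1%:P)) None (-2) 1.
Proof.
rewrite rmorphB; have [->|x10] := eqVneq x1 0.
  by rewrite rmorph0 subr0; apply: leading_x_infinity.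
have := leadingDl on_infinity _ leading_x_infinity (@leadingC (- x1) None _).
by rewrite /c polyCN rmorphN; apply; rewrite ?oppr_eq0.
Qed.

(** The two points may coincide, in which case y1 = 0 and the order is 2. *)
Lemma principal_vertical x1 y1 : nonsingular E -> on (Some (x1, y1)) ->
  principal (pf ('X - x1%:P)) (fun T =>
    (T == Some (x1, y1))%:Z + (T == Some (x1, - y1))%:Z - 2 * (T == None)%:Z).
Proof.
move=> nsE on1 [[x0 y0]|] onT; last by exists 1; apply: leading_vertical_infinity.
rewrite /= !(inj_eq Some_inj) !xpair_eqE mulr0 subr0.
move: (on1) (onT); rewrite /on_curve -!cubic_horner => /eqP e1 /eqP e0.
have [y00|y00] := eqVneq y0 0; last first.
  have [k hk] := leading_pfXsubC x1 onT y00; exists k.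
  have [x01|x01] := eqVneq x0 x1; last by rewrite (negPf x01) in hk.
  move: hk; rewrite x01 eqxx /=.
  have : (y0 == y1) || (y0 == - y1) by rewrite -eqf_sqr e0 e1 x01.
  have [<-|_] /= := eqVneq y0 y1; last by move=> ->.
  have -> // : (y0 == - y0) = false.
  rewrite -subr_eq0 opprK -mulr2n -mulr_natl mulf_eq0 (negPf two_neq0) /=.
  exact: negPf y00.
have [x01|x01] /= := eqVneq x0 x1; last first.
  exists (x0 - x1); apply: leading_regular; first by rewrite subr_eq0.
  by have := regular_value_pf ('X - x1%:P) onT; rewrite !hornerE.
have r0 : cubic.[x0] = 0 by rewrite -e0 y00 expr0n.
have y10 : y1 = 0.
  by apply/eqP; rewrite -sqrf_eq0 e1 -x01 r0.
rewrite y10 y00 oppr0 eqxx -x01 (pfXsubC_branch r0).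
have q0 := cubic_quot_neq0 nsE r0.
exists ((cubic_quot x0).[x0])^-1; split; first by rewrite invr_eq0.
exists (pf (cubic_quot x0))^-1; last by rewrite /= eqxx.
by apply: regular_valueV q0 _; rewrite -y00; apply: regular_value_pf.
Qed.

Definition slope (x1 y1 x2 y2 : F) : F :=
  if x1 == x2 then (3 * x1 ^+ 2 + wA E) / (2 * y1) else (y2 - y1) / (x2 - x1).

Definition third_x (x1 y1 x2 y2 : F) : F := slope x1 y1 x2 y2 ^+ 2 - x1 - x2.

Definition line (x1 y1 x2 y2 : F) : {poly F} :=
  y1%:P + (slope x1 y1 x2 y2)%:P * ('X - x1%:P).

Lemma ec_addE x1 y1 x2 y2 : ~~ ((x1 == x2) && (y1 == - y2)) ->
  ec_add E (Some (x1, y1)) (Some (x2, y2)) =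
  Some (third_x x1 y1 x2 y2, - (line x1 y1 x2 y2).[third_x x1 y1 x2 y2]).
Proof.
move=> /negPf h; rewrite /ec_add h /third_x /line /slope; congr (Some (_, _)).
by rewrite !hornerE; case: ifP => _; ring.
Qed.

(** The coefficients of the curve in terms of its three intersection points with
    the line, for chords and tangents alike. *)
Lemma chord_coefs x1 y1 x2 y2 (l := slope x1 y1 x2 y2) (x3 := third_x x1 y1 x2 y2) :
  on (Some (x1, y1)) -> on (Some (x2, y2)) -> ~~ ((x1 == x2) && (y1 == - y2)) ->
  [/\ y2 = y1 + l * (x2 - x1),
    wA E = x1 * x2 + x1 * x3 + x2 * x3 + 2 * l * (y1 - l * x1) &
    wB E = (y1 - l * x1) ^+ 2 - x1 * x2 * x3].
Proof.
rewrite /on_curve => /eqP e1 /eqP e2 nopp.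
have B : wB E = y1 ^+ 2 - x1 ^+ 3 - wA E * x1 by rewrite e1; ring.
rewrite /l /x3 /third_x /slope {l x3}.
have [x12|x12] := eqVneq x1 x2; last first.
  have d0 : x2 - x1 != 0 by rewrite subr_eq0 eq_sym.
  have A : wA E = (y2 ^+ 2 - y1 ^+ 2 - x2 ^+ 3 + x1 ^+ 3) / (x2 - x1).
    by apply: (mulIf d0); rewrite divfK // e1 e2; ring.
  by rewrite B A; split; field.
have y12 : y2 = y1.
  have : (y1 == y2) || (y1 == - y2) by rewrite -eqf_sqr e1 e2 x12.
  by case/orP => [/eqP//|y12]; rewrite x12 y12 eqxx in nopp.
have y10 : y1 != 0.
  by apply: contra nopp => /eqP y10; rewrite x12 y12 y10 oppr0 !eqxx.
rewrite y12 B -x12; set l := _ / _.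
have -> : wA E = l * (2 * y1) - 3 * x1 ^+ 2.
  by rewrite /l divfK ?mulf_neq0 //; ring.
by split; ring.
Qed.

Lemma line_horner x1 y1 x2 y2 x0 :
  (line x1 y1 x2 y2).[x0] = y1 + slope x1 y1 x2 y2 * (x0 - x1).
Proof. by rewrite /line !hornerE. Qed.

Section Line.
Variables (x1 y1 x2 y2 : F).
Hypothesis on1 : on (Some (x1, y1)).
Hypothesis on2 : on (Some (x2, y2)).
Hypothesis nopp : ~~ ((x1 == x2) && (y1 == - y2)).
Local Notation l := (slope x1 y1 x2 y2).
Local Notation x3 := (third_x x1 y1 x2 y2).
Local Notation ell := (line x1 y1 x2 y2).

Lemma cubic_sub_line :
  cubic - ell ^+ 2 = ('X - x1%:P) * ('X - x2%:P) * ('X - x3%:P).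
Proof.
have [_ eA eB] := chord_coefs on1 on2 nopp; rewrite /cubic eA eB /line /third_x.
by rewrite -mul_polyC; ring.
Qed.

Lemma horner_cubic_sub_line x0 :
  cubic.[x0] - ell.[x0] ^+ 2 = (x0 - x1) * (x0 - x2) * (x0 - x3).
Proof.
by have := congr1 (horner^~ x0) cubic_sub_line; rewrite !hornerM !hornerXsubC => <-; rewrite hornerD hornerN horner_exp.
Qed.

Lemma on_third : on (Some (x3, ell.[x3])).
Proof.
rewrite /on_curve -cubic_horner eq_sym -subr_eq0 horner_cubic_sub_line.
by rewrite subrr mulr0.
Qed.

Lemma leading_line_infinity : leading (y - pf ell) None (-3) 1.
Proof.
have [->|e0] := eqVneq ell 0; first by rewrite rmorph0 subr0; exact: leading_y_infinity.
rewrite -rmorphN; have ne0 : - ell != 0 by rewrite oppr_eq0.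
apply: leadingDl on_infinity _ leading_y_infinity (leading_pf_infinity ne0).
have : (size (- ell) <= 2)%N.
  rewrite size_polyN /line (leq_trans (size_polyD _ _)) // geq_max.
  rewrite (leq_trans (size_polyC_leq1 _)) //= mul_polyC.
  by rewrite (leq_trans (size_scale_leq _ _)) // size_XsubC.
by case: (size _) => [|[|[|]]].
Qed.

(** Since (y - l)(y + l) = (x - x1)(x - x2)(x - x3), the order of y - l at
    a point of the line is the number of the x_i equal to its abscissa, as long as
    y + l does not vanish there, that is, y0 <> 0.  If y0 = 0 the uniformizer is y,
    the order is 1, and x0 is a simple root of the product. *)
Lemma principal_line : nonsingular E -> principal (y - pf ell) (fun T =>
  (T == Some (x1, y1))%:Z + (T == Some (x2, y2))%:Z +
  (T == ec_opp (ec_add E (Some (x1, y1)) (Some (x2, y2))))%:Z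
  - 3 * (T == None)%:Z).
Proof.
move=> nsE [[x0 y0]|] onT; last first.
  by rewrite ec_addE //; exists 1; apply: leading_line_infinity.
rewrite ec_addE //= opprK mulr0 subr0.
have [e2 eA _] := chord_coefs on1 on2 nopp.
have l1 : ell.[x1] = y1 by rewrite line_horner subrr mulr0 addr0.
have l2 : ell.[x2] = y2 by rewrite line_horner.
have -> : Some (x1, y1) = Some (x1, ell.[x1]) by rewrite l1.
have -> : Some (x2, y2) = Some (x2, ell.[x2]) by rewrite l2.
have rl : regular_value (y - pf ell) (Some (x0, y0)) (y0 - ell.[x0]).
  apply: (regular_valueD onT); first exact: regular_value_chart2 (Some (x0, y0)).
  exact/regular_valueN/regular_value_pf.
have [y0E|y0E] := eqVneq y0 ell.[x0]; last first.
  have no x' : (Some (x0, y0) == Some (x', ell.[x'])) = false.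
    by apply: contraNF y0E => /eqP[-> ->].
  rewrite !no; exists (y0 - ell.[x0]); rewrite [X in leading _ _ X _](_ : _ = 0) //.
  apply: leading_regular => //.
  by rewrite subr_eq0.
have yes x' : (Some (x0, y0) == Some (x', ell.[x'])) = (x0 == x').
  rewrite (inj_eq Some_inj) xpair_eqE y0E; have [->|//] := eqVneq x0 x'.
  by rewrite eqxx.
rewrite !yes; have e0 : y0 ^+ 2 = cubic.[x0] by apply/eqP; rewrite cubic_horner.
have [y00|y00] := eqVneq y0 0; last first.
  have rlbar : leading (y + pf ell) (Some (x0, y0)) 0 (2 * y0).
    apply: leading_regular; first by rewrite mulf_neq0.
    have -> : 2 * y0 = y0 + ell.[x0] by rewrite -y0E; ring.
    apply: (regular_valueD onT); first exact: regular_value_chart2 (Some (x0, y0)).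
    exact: regular_value_pf.
  have lbar0 : y + pf ell != 0.
    apply/eqP => h; have : pf ell + pf 1 * y = 0 by rewrite rmorph1 mul1r addrC.
    by move=> /pf_indep[_ /eqP]; rewrite oner_eq0.
  have -> : y - pf ell =
      pf ('X - x1%:P) * pf ('X - x2%:P) * pf ('X - x3%:P) * (y + pf ell)^-1.
    apply: (mulIf lbar0); rewrite mulfVK // -!rmorphM -cubic_sub_line.
    by rewrite rmorphB -y_sqr rmorphXn; ring.
  have [k1 h1] := leading_pfXsubC x1 onT y00.
  have [k2 h2] := leading_pfXsubC x2 onT y00.
  have [k3 h3] := leading_pfXsubC x3 onT y00.
  have := leadingM (leadingM (leadingM h1 h2) h3) (leadingV rlbar).
  by rewrite subr0 => h; eexists; exact: h.
have r0 : cubic.[x0] = 0 by rewrite -e0 y00 expr0n.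
have q0 := cubic_quot_neq0 nsE r0.
have ellE : ell = l%:P * ('X - x0%:P).
  have : y1 + l * (x0 - x1) = 0 by rewrite -line_horner -y0E.
  move/eqP; rewrite addr_eq0 => /eqP h; rewrite /line {1}h.
  by rewrite rmorphN rmorphM rmorphB; ring.
(* The derivative of (X - x1)(X - x2)(X - x3) at x0 is that of the cubic, hence nonzero. *)
have -> : (x0 == x1)%:Z + (x0 == x2)%:Z + (x0 == x3)%:Z = 1.
  have prod0 := horner_cubic_sub_line x0.
  rewrite r0 -y0E y00 expr0n subrr in prod0.
  have : (x0 - x2) * (x0 - x3) + (x0 - x1) * (x0 - x3) + (x0 - x1) * (x0 - x2) != 0.
    have -> // : (x0 - x2) * (x0 - x3) + (x0 - x1) * (x0 - x3) + (x0 - x1) * (x0 - x2) = (cubic_quot x0).[x0].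
    have : ell.[x0] = 0 by rewrite -y0E.
    rewrite line_horner => /eqP; rewrite addr_eq0 => /eqP h.
    move: eA h; rewrite /cubic_quot !hornerE /= /third_x.
    by move: (slope _ _ _ _) => s -> ->; ring.
  move/eqP: prod0; rewrite eq_sym !mulf_eq0 !subr_eq0.
  move: (third_x _ _ _ _) => z.
  have [<-|_] := eqVneq x0 x1; have [<-|_] := eqVneq x0 x2; have [<-|_] := eqVneq x0 z;
    by rewrite ?subrr ?(mulr0, mul0r, addr0, add0r) ?eqxx.
exists 1; split; first exact: oner_neq0.
exists (1 - c l * (y * (pf (cubic_quot x0))^-1)).
  have -> : (1 : F) = 1 - l * (y0 / (cubic_quot x0).[x0]) by rewrite y00 mul0r mulr0 subr0.
  apply: (regular_valueD onT); first exact: regular_value1.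
  apply/regular_valueN/regular_valueM; first exact: regular_valueC.
  apply: regular_valueM; first exact: regular_value_chart2 (Some (x0, y0)).
  by apply: regular_valueV q0 _; apply: regular_value_pf.
rewrite /= y00 eqxx ellE rmorphM -/(c l) pfXsubC_branch // expr1z.
by ring.
Qed.

End Line.

(** * Miller functions *)

Lemma on_ec_opp T : on T -> on (ec_opp T).
Proof. by case: T => [[x0 y0]|] //=; rewrite sqrrN. Qed.

Lemma on_ec_add S T : on S -> on T -> on (ec_add E S T).
Proof.
case: S T => [[x1 y1]|] [[x2 y2]|] // on1 on2.
have [opp|nopp] := boolP ((x1 == x2) && (y1 == - y2)); first by rewrite /ec_add opp.
by rewrite ec_addE //; apply: (on_ec_opp (on_third on1 on2 nopp)).
Qed.

(** For S = [n]Q this is the factor f_{n+1,Q} / f_{n,Q}. *)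
Definition step_fun (Q S : ecpoint F) : L :=
  match Q, S, ec_add E Q S with
  | Some (x1, y1), Some (x2, y2), Some (x3, _) =>
      (y - pf (line x1 y1 x2 y2)) / pf ('X - x3%:P)
  | _, _, _ => 1
  end.

Definition vertical_fun (S : ecpoint F) : L :=
  if S is Some (x1, _) then pf ('X - x1%:P) else 1.

Definition step_val (Q S P : ecpoint F) : F :=
  match Q, S, ec_add E Q S, P with
  | Some (x1, y1), Some (x2, y2), Some (x3, _), Some (xP, yP) =>
      (yP - (line x1 y1 x2 y2).[xP]) / (xP - x3)
  | _, _, _, _ => 1
  end.

Lemma principal_step Q S : nonsingular E -> on Q -> on S -> Q != None ->
  S != None -> ec_add E Q S != None ->
  principal (step_fun Q S) (fun T => (T == Q)%:Z + (T == S)%:Z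
    - (T == ec_add E Q S)%:Z - (T == None)%:Z) /\
  leading (step_fun Q S) None (-1) 1.
Proof.
case: Q S => [[x1 y1]|//] [[x2 y2]|//] nsE on1 on2 _ _.
have [opp|nopp] := boolP ((x1 == x2) && (y1 == - y2)); first by rewrite /ec_add opp.
have onS := on_ec_add on1 on2; have hl := principal_line on1 on2 nopp nsE.
move: onS hl; rewrite /step_fun ec_addE // => onS hl _.
split; last first.
  have := leadingM (leading_line_infinity x1 y1 x2 y2)
    (leadingV (leading_vertical_infinity (third_x x1 y1 x2 y2))).
  by rewrite invr1 mulr1.
apply: eq_principal (principalM hl (principalV (principal_vertical nsE onS))) => T.
by rewrite /=; ring.
Qed.

Lemma regular_value_step Q S xP yP : on (Some (xP, yP)) ->
  (if ec_add E Q S is Some (x3, _) then xP != x3 else true) ->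
  regular_value (step_fun Q S) (Some (xP, yP)) (step_val Q S (Some (xP, yP))).
Proof.
move=> onP; rewrite /step_fun /step_val.
case: Q S => [[x1 y1]|] [[x2 y2]|]; try by move=> _; exact: regular_value1.
case: (ec_add _ _ _) => [[x3 y3]|_] => [x30|]; last exact: regular_value1.
apply: regular_valueM.
  apply: (regular_valueD onP); first exact: regular_value_chart2 (Some (xP, yP)).
  by apply/regular_valueN/regular_value_pf.
apply: regular_valueV; first by rewrite subr_eq0.
by have := regular_value_pf ('X - x3%:P) onP; rewrite hornerXsubC.
Qed.

(** Convertible to [ec_mul] at a natural number. *)
Definition ec_muln (Q : ecpoint F) n := iter n (ec_add E Q) None.

Lemma on_ec_muln Q n : on Q -> on (ec_muln Q n).
Proof. by move=> onQ; elim: n => //= n IH; apply: on_ec_add. Qed.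

(** The index is shifted by one: this is f_{n+1,Q}, a product of n steps. *)
Fixpoint miller_fun Q n : L :=
  if n is m.+1 then miller_fun Q m * step_fun Q (ec_muln Q m.+1) else 1.

Fixpoint miller_val Q P n : F :=
  if n is m.+1 then miller_val Q P m * step_val Q (ec_muln Q m.+1) P else 1.

Definition xcoord_neq (P T : ecpoint F) : Prop :=
  forall xP yP xT yT, P = Some (xP, yP) -> T = Some (xT, yT) -> xP != xT.

Section Miller.
Variables (Q : ecpoint F) (n : nat).
Hypothesis nsE : nonsingular E.
Hypothesis onQ : on Q.
Hypothesis mulQ_neq0 : forall i, (0 < i <= n.+1)%N -> ec_muln Q i != None.

Lemma miller_fun_principal : exists m, leading (miller_fun Q n) None m 1 /\
  principal (miller_fun Q n) (miller_divisor E n.+1 Q).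
Proof.
have Q0 : Q != None by have := @mulQ_neq0 1 isT; case: (Q).
have mul1 : ec_muln Q 1 = Q by case: (Q) => [[]|].
move: mulQ_neq0; elim: n => [|j IH] neq0.
  exists 0; split; first by apply: leading_regular (oner_neq0 _) (regular_value1 _).
  move=> T onT; exists 1; rewrite [miller_divisor _ _ _ _](_ : _ = 0).
    by apply: leading_regular (oner_neq0 _) (regular_value1 _).
  by rewrite /miller_divisor -[ec_mul _ _ _]/(ec_muln Q 1) mul1; lia.
have [|m [lm pm]] := IH; first by move=> i hi; apply: neq0; lia.
have neq1 : ec_muln Q j.+1 != None by apply: neq0; lia.
have neq2 : ec_muln Q j.+2 != None by apply: neq0; lia.
have [pS lS] := principal_step nsE onQ (on_ec_muln j.+1 onQ) Q0 neq1 neq2.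
exists (m + -1); split; first by have := leadingM lm lS; rewrite mulr1.
apply: eq_principal (principalM pm pS) => T.
rewrite /miller_divisor -[ec_mul _ j.+1 _]/(ec_muln Q j.+1).
rewrite -[ec_mul _ j.+2 _]/(ec_add E Q (ec_muln Q j.+1)) !intS.
by ring.
Qed.

(** Adding the divisor ([m]Q) + (-[m]Q) - 2(O) of the vertical, with m = n + 1,
    turns the term - ([m]Q) into (-[m]Q); inverting gives f_{-m,Q}. *)
Lemma miller_fun_neg_principal :
  let f := (miller_fun Q n * vertical_fun (ec_muln Q n.+1))^-1 in
  exists m, leading f None m 1 /\ principal f (miller_divisor E (- n.+1%:Z) Q).
Proof.
have [m [lm pm]] := miller_fun_principal.
have onn := on_ec_muln n.+1 onQ; have := @mulQ_neq0 n.+1; rewrite ltnSn => /(_ isT).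
have emul : ec_mul E n.+1 Q = ec_muln Q n.+1 by [].
have emulN : ec_mul E (- n.+1%:Z) Q = ec_opp (ec_muln Q n.+1) by [].
move: emul emulN onn; case: (ec_muln Q n.+1) => [[x1 y1]|//] e1 e2 on1 _.
exists (- (m + -2)); split.
  by have := leadingV (leadingM lm (leading_vertical_infinity x1)); rewrite mulr1 invr1.
apply: eq_principal (principalV (principalM pm (principal_vertical nsE on1))) => T.
by rewrite /miller_divisor e1 e2 /= !intS; ring.
Qed.

Variable P : ecpoint F.
Hypothesis onP : on P.
Hypothesis P_neq0 : P != None.
Hypothesis mulQ_x : forall i, (0 < i <= n.+1)%N -> xcoord_neq P (ec_muln Q i).

Lemma regular_value_miller : regular_value (miller_fun Q n) P (miller_val Q P n).
Proof.
move: mulQ_x; elim: n => [|j IH] neqx; first exact: regular_value1.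
apply: regular_valueM; first by apply: IH => i /andP[i0 /leqW iM]; apply: neqx; rewrite i0.
move: P_neq0 onP neqx; case: (P) => [[xP yP]|//] _ onP' neqx.
apply: regular_value_step => //; rewrite -[ec_add _ _ _]/(ec_muln Q j.+2).
case E3 : (ec_muln Q j.+2) => [[x3 y3]|//].
by apply: (neqx j.+2 _ _ _ _ _ (erefl _) E3); rewrite ltnSn.
Qed.

Lemma regular_value_miller_neg : miller_val Q P n != 0 ->
  regular_value (miller_fun Q n * vertical_fun (ec_muln Q n.+1))^-1 P
   (miller_val Q P n * (if (P, ec_muln Q n.+1) is (Some (xP, _), Some (x1, _)) then xP - x1 else 1))^-1.
Proof.
move=> v0; have := @mulQ_x n.+1; rewrite ltnSn => /(_ isT).
have := @mulQ_neq0 n.+1; rewrite ltnSn => /(_ isT).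
have rm := regular_value_miller.
move: P_neq0 onP rm v0; case: (P) => [[xP yP]|//] _ onP'.
case: (ec_muln Q n.+1) => [[x1 y1]|//] rm v0 _ /(_ _ _ _ _ erefl erefl) xP1.
apply: regular_valueV; first by rewrite mulf_neq0 // subr_eq0.
apply: regular_valueM rm _; rewrite /=.
by have := regular_value_pf ('X - x1%:P) onP'; rewrite hornerXsubC.
Qed.

End Miller.

End CoordinateRing.

(** * The function field *)

Lemma common_denominator (R : comNzRingType) (z1 z2 w d1 d2 n1 n2 : R) :
  z1 * d1 = n1 -> z2 * d2 = n2 ->
  (z1 + z2 * w) * (d1 * d2) = n1 * d2 + n2 * d1 * w.
Proof. by move=> <- <-; ring. Qed.

Section FunctionField.
Variables (F : fieldType) (E : weierstrass F).
Local Notation L := (funfield E).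
Local Notation x := (fx E).
Local Notation y := (fy E).

Definition polyf : {poly F} -> L := qpolyC (curve_poly E) \o @tofrac _.
Fact polyf_zmod : zmod_morphism polyf.
Proof. by move=> a b; rewrite /polyf /= !rmorphB. Qed.
Fact polyf_monoid : monoid_morphism polyf.
Proof. by split=> [|a b]; rewrite /polyf /= ?rmorph1 ?rmorphM. Qed.
HB.instance Definition _ := GRing.isZmodMorphism.Build {poly F} L polyf polyf_zmod.
HB.instance Definition _ := GRing.isMonoidMorphism.Build {poly F} L polyf polyf_monoid.


Lemma size_curve_poly : size (curve_poly E) = 3.
Proof.
rewrite /curve_poly size_polyDl size_polyXn // size_polyN.
by rewrite (leq_ltn_trans (size_polyC_leq1 _)).
Qed.

Lemma mk_monic_curve : mk_monic (curve_poly E) = curve_poly E.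
Proof.
by have [_ mE] := curve_poly_irr E; rewrite /mk_monic size_curve_poly mE.
Qed.

Lemma fy_sqr : y ^+ 2 = polyf (cubic E).
Proof.
rewrite /y /polyf /= /qpolyX -rmorphXn /=.
apply/val_inj => /=; rewrite mk_monic_curve.
have -> : 'X^2 = curve_poly E + (tofrac (cubic E))%:P by rewrite /curve_poly subrK.
have [_ mE] := curve_poly_irr E.
rewrite Pdiv.RingMonic.rmodpD // Pdiv.RingMonic.rmodpp // add0r.
by rewrite Pdiv.Ring.rmodp_small // size_curve_poly (leq_ltn_trans (size_polyC_leq1 _)).
Qed.


Definition fracf : {fraction {poly F}} -> L := qpolyC (curve_poly E).
Fact fracf_zmod : zmod_morphism fracf.
Proof. by move=> a b; rewrite /fracf rmorphB. Qed.
Fact fracf_monoid : monoid_morphism fracf.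
Proof. by split=> [|a b]; rewrite /fracf ?rmorph1 ?rmorphM. Qed.
HB.instance Definition _ := GRing.isZmodMorphism.Build _ L fracf fracf_zmod.
HB.instance Definition _ := GRing.isMonoidMorphism.Build _ L fracf fracf_monoid.

(** Elements of the quotient are represented by their remainders z1 + z2 Y. *)
Lemma val_fracf_pair z1 z2 :
  val (fracf z1 + fracf z2 * y : {poly %/ curve_poly E}) = z1%:P + z2 *: 'X.
Proof.
have -> : fracf z1 + fracf z2 * y =
   in_qpoly (curve_poly E) (z1%:P + z2 *: 'X) :> {poly %/ curve_poly E}.
  rewrite rmorphD /=; congr (_ + _).
    apply: val_inj; rewrite /= mk_monic_curve Pdiv.Ring.rmodp_small //.
    by rewrite size_curve_poly (leq_ltn_trans (size_polyC_leq1 _)).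
  rewrite -mul_polyC rmorphM /=; congr (_ * _).
  apply: val_inj; rewrite /= mk_monic_curve Pdiv.Ring.rmodp_small //.
  by rewrite size_curve_poly (leq_ltn_trans (size_polyC_leq1 _)).
apply: in_qpoly_small; rewrite mk_monic_curve size_curve_poly.
rewrite (leq_ltn_trans (size_polyD _ _)) // gtn_max.
rewrite (leq_ltn_trans (size_polyC_leq1 _)) //=.
by rewrite (leq_ltn_trans (size_scale_leq _ _)) // size_polyX.
Qed.

Lemma fracf_pairP (h : L) : exists z1 z2, h = fracf z1 + fracf z2 * y.
Proof.
have : (size (polyn (h : {poly %/ curve_poly E})) <= 2)%N.
  apply: leq_trans (size_npoly (h : {poly %/ curve_poly E})) _.
  by rewrite mk_monic_curve size_curve_poly.
move Eq : (polyn _) => q szq.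
exists q`_0, q`_1; apply/val_inj; rewrite val_fracf_pair [LHS]Eq.
apply/polyP => i; rewrite coefD coefC coefZ coefX.
case: i => [|[|i]]; rewrite ?eqxx ?mulr0 ?mulr1 ?addr0 ?add0r //.
by rewrite nth_default ?mulr0 // (leq_trans szq).
Qed.

Lemma polyf_indep a b : polyf a + polyf b * y = 0 -> a = 0 /\ b = 0.
Proof.
move=> h; have {h} : (tofrac a)%:P + tofrac b *: 'X = 0.
  by rewrite -val_fracf_pair -[LHS]/(val (polyf a + polyf b * y)) h.
move=> h; have e i : ((tofrac a)%:P + tofrac b *: 'X)`_i = 0.
  by rewrite h coef0.
have := e 1%N; rewrite coefD coefC coefZ coefX add0r mulr1 => /eqP.
rewrite tofrac_eq0 => /eqP->; split=> //.
have := e 0%N; rewrite coefD coefC coefZ coefX mulr0 addr0 => /eqP.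
by rewrite tofrac_eq0 => /eqP->.
Qed.

Lemma funfield_repr (h : L) : exists m n1 n2,
  m != 0 /\ h * polyf m = polyf n1 + polyf n2 * y.
Proof.
have [z1 [z2 ->]] := fracf_pairP h.
have [n1 [d1 [d1n0 e1]]] := fracE z1.
have [n2 [d2 [d2n0 e2]]] := fracE z2.
exists (d1 * d2), (n1 * d2), (n2 * d1); split; first by rewrite mulf_neq0.
have f1 : fracf z1 * polyf d1 = polyf n1 by rewrite -[RHS]/(fracf _) -e1 rmorphM.
have f2 : fracf z2 * polyf d2 = polyf n2 by rewrite -[RHS]/(fracf _) -e2 rmorphM.
by rewrite !rmorphM /=; apply: common_denominator.
Qed.


Lemma has_valueE (f : L) T v : has_value f T v <-> regular_value polyf y f T v.
Proof.
by case: T => [[x0 y0]|].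
Qed.

Lemma has_leading_termE (f : L) T n k :
  has_leading_term f T n k <-> leading polyf y f T n k.
Proof.
rewrite /has_leading_term /leading.
have -> : uniformizer E T = unif polyf y T by case: T => [[x0 y0]|].
by split=> -[k0 [g hg fE]]; split=> //; exists g => //; apply/has_valueE.
Qed.

Lemma has_divisorE (f : L) D : has_divisor f D <-> principal E polyf y f D.
Proof.
by split=> h T /h[k hk]; exists k; apply/has_leading_termE.
Qed.

Hypothesis F_closed : forall q : {poly F}, size q != 1 -> exists x, root q x.
Hypothesis two_neq0 : (2 : F) != 0.

Lemma fun_evalE (f : L) T v : on_curve E T -> regular_value polyf y f T v ->
  fun_eval f T = v.
Proof.
move=> onT h; apply: xget_unique; first exact/has_valueE.
move=> w /has_valueE hw.
exact: (regular_value_inj fy_sqr polyf_indep onT hw h).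
Qed.

Lemma millerE n Q (f : L) m : leading polyf y f None m 1 ->
  principal E polyf y f (miller_divisor E n Q) -> miller E n Q = f.
Proof.
move=> lf pf; apply: xget_unique; first split.
- exact/has_divisorE.
- by exists m; apply/has_leading_termE.
move=> g [/has_divisorE pg [m' /has_leading_termE lg]].
exact: (principal_normalized_inj fy_sqr polyf_indep funfield_repr F_closed two_neq0 pg pf lg lf).
Qed.

End FunctionField.

(** * Division values and the net *)

(** Let p_i = psi_(m+i) for consecutive division values, and dr, ds, dt the
    differences x_Q - x_[i]Q for i = m+2, m+3, m+4.  The recurrence of the
    abscissas and the recurrence of psi give the formula for dt from those for
    ds and dr. *)
Lemma division_value_step (R : idomainType) (c3 p1 p2 p3 p4 p5 dr ds dt c2 : R) :
  p1 != 0 -> p3 != 0 ->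
  dt * dr * ds ^+ 2 = c2 ^+ 2 * ds - c3 -> ds * p3 ^+ 2 = p4 * p2 ->
  dr * p2 ^+ 2 = p3 * p1 -> p5 * p1 = p4 * p2 * c2 ^+ 2 - c3 * p3 ^+ 2 ->
  dt * p4 ^+ 2 = p5 * p3.
Proof.
move=> p10 p30 h1 h2 h3 h4; apply: (mulIf (mulf_neq0 p30 p10)).
apply/eqP; rewrite -subr_eq0; apply/eqP.
rewrite -{1}h3.
have -> : dt * p4 ^+ 2 * (dr * p2 ^+ 2) = dt * dr * (p4 * p2) ^+ 2 by ring.
rewrite -h2; have -> : dt * dr * (ds * p3 ^+ 2) ^+ 2 = (dt * dr * ds ^+ 2) * p3 ^+ 4 by ring.
rewrite h1; have -> : p5 * p3 * (p3 * p1) = p5 * p1 * p3 ^+ 2 by ring.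
by rewrite h4 -h2; ring.
Qed.

(** The inductive step of [phi_step], with D, Dn, Ds the differences of x_P with
    the abscissas of Q, [n]Q, [n+1]Q, with L, L1 the values at P of the chords
    through Q and [n]Q, [n+1]Q, and with L' the first chord at -P. *)
Lemma net_step (R : idomainType) (phi0 phi1 phi2 psi0 psi1 psi2 c D Dn Ds L L' L1 e : R) :
  psi0 != 0 -> L != 0 ->
  phi1 * psi0 * D * Dn = phi0 * psi1 * L ->
  D * psi0 * phi2 = psi2 * phi0 - c * psi1 * phi1 ->
  L * L' = - (D * Dn * Ds) -> (L1 + L') * e = - (c * Ds) ->
  e * psi1 ^+ 2 = psi2 * psi0 ->
  phi2 * psi1 * D * Ds = phi1 * psi2 * L1.
Proof.
move=> p0 L0 /eqP + /eqP + /eqP + /eqP + /eqP.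
rewrite -!(subr_eq0 (_ * _)) => /eqP h1 /eqP h2 /eqP h3 /eqP h4 /eqP h5.
apply/eqP; rewrite -subr_eq0; apply/eqP/(mulIf (mulf_neq0 p0 L0)); rewrite mul0r.
(* The hypotheses are used in the order h2, h1, h3, h4, h5 to eliminate phi2, phi0, D Dn Ds, c Ds, e psi1^2. *)
transitivity (psi1 * Ds * L * (D * psi0 * phi2 - (psi2 * phi0 - c * psi1 * phi1))
  - Ds * psi2 * (phi1 * psi0 * D * Dn - phi0 * psi1 * L)
  + psi2 * phi1 * psi0 * (L * L' - - (D * Dn * Ds))
  - psi1 ^+ 2 * phi1 * L * ((L1 + L') * e - - (c * Ds))
  + (L1 + L') * phi1 * L * (e * psi1 ^+ 2 - psi2 * psi0)); first by ring.
by rewrite h1 h2 h3 h4 h5 !mulr0 !subr0 !addr0.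
Qed.

Section Net.
Variables (F : fieldType) (E : weierstrass F) (xq yq xp yp : F) (W : int * int -> F).
Local Notation Q := (Some (xq, yq)).
Local Notation P := (Some (xp, yp)).
Local Notation on T := (on_curve E T).
Hypothesis netW : is_net_of E Q P W.
Hypothesis onQ : on Q.
Hypothesis two_neq0 : (2 : F) != 0.
Hypothesis yq_neq0 : yq != 0.

Let psi (n : nat) : F := W (n%:Z, 0).
Let phi (n : nat) : F := W (n%:Z, 1).

Lemma net_rel (p1 p2 q1 q2 r1 r2 s1 s2 : int) :
  W (p1 + q1 + s1, p2 + q2 + s2) * W (p1 - q1, p2 - q2) * W (r1 + s1, r2 + s2) * W (r1, r2)
  + W (q1 + r1 + s1, q2 + r2 + s2) * W (q1 - r1, q2 - r2) * W (p1 + s1, p2 + s2) * W (p1, p2)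
  + W (r1 + p1 + s1, r2 + p2 + s2) * W (r1 - p1, r2 - p2) * W (q1 + s1, q2 + s2) * W (q1, q2) = 0.
Proof. by case: netW => -[net _ _] _; apply: (net (p1, p2) (q1, q2) (r1, r2) (s1, s2)). Qed.

Lemma netN (a b : int) : W (- a, - b) = - W (a, b).
Proof. by case: netW => -[_ _ oddW] _; apply: (oddW (a, b)). Qed.

(** The net relation at p = (n+2,0), q = (2,0), r = (1,0), s = 0. *)
Lemma psi_rec n : psi n.+4 * psi n = psi n.+3 * psi n.+1 * psi 2 ^+ 2 - psi 3 * psi n.+2 ^+ 2.
Proof.
have := net_rel n.+2%:Z 0 2 0 1 0 0 0.
have [_ [[W10 _ _] _]] := netW.
rewrite !addr0 ?subr0.
have -> : n.+2%:Z + 2 = n.+4%:Z by lia.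
have -> : n.+2%:Z - 2 = n%:Z by lia.
have -> : 1 + n.+2%:Z = n.+3%:Z by lia.
have -> : 1 - n.+2%:Z = - n.+1%:Z by lia.
have -> : W (- n.+1%:Z, 0) = - psi n.+1 by rewrite -{1}[0]oppr0 netN.
rewrite [2 + 1](_ : _ = 3) // [2 - 1](_ : _ = 1) // W10 -!/(psi _) => h.
apply/eqP; rewrite -subr_eq0 -h; apply/eqP; ring.
Qed.

(** The net relation at p = (n+1,0), q = (1,0), r = (-1,0), s = (0,1): it is
    linear in phi. *)
Lemma phi_rec n : (xp - xq) * psi n * phi n.+2 =
  psi n.+2 * phi n - psi 2 * psi n.+1 * phi n.+1.
Proof.
have := net_rel n.+1%:Z 0 1 0 (-1) 0 0 1.
have [_ [[W10 W01 W11] [_ [_ Wm11 _]]]] := netW.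
rewrite !addr0 ?subr0 !add0r.
have -> : n.+1%:Z + 1 = n.+2%:Z by lia.
have -> : n.+1%:Z - 1 = n%:Z by lia.
have -> : -1 + n.+1%:Z = n%:Z by lia.
have -> : -1 - n.+1%:Z = - n.+2%:Z by lia.
have -> : W (- n.+2%:Z, 0) = - psi n.+2 by rewrite -{1}[0]oppr0 netN.
have -> : W (-1, 0) = - 1 by rewrite -{1}[0]oppr0 netN W10.
rewrite [1 - -1](_ : _ = 2) // W10 W01 W11 Wm11.
rewrite -!/(psi _) -!/(phi _) => h.
apply/eqP; rewrite -subr_eq0 -h; apply/eqP; ring.
Qed.

(** The net relation at p = (n+1,0), q = (0,1), r = (1,0), s = 0. *)
Lemma phi_neg n : phi n.+1 * W (- n.+1%:Z, 1) =
  - ((xp - xq) * psi n.+1 ^+ 2 + psi n.+2 * psi n).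
Proof.
have := net_rel n.+1%:Z 0 0 1 1 0 0 0.
have [_ [[W10 W01 W11] [_ [_ Wm11 _]]]] := netW.
rewrite !addr0 !add0r ?subr0.
have -> : 1 + n.+1%:Z = n.+2%:Z by lia.
have -> : 1 - n.+1%:Z = - n%:Z by lia.
have -> : W (- n%:Z, 0) = - psi n by rewrite -{1}[0]oppr0 netN.
have -> : W (n.+1%:Z, -1) = - W (- n.+1%:Z, 1) by rewrite -netN !opprK.
rewrite W10 W01 W11 Wm11 -!/(psi _) -!/(phi _) => h.
apply/eqP; rewrite -subr_eq0 -oppr0 -h; apply/eqP; ring.
Qed.

(** For S = Q + R the point -S lies on the line through Q and R, so that both
    lines through Q can be expressed by the coordinates of Q and S.  It is in
    this form that R = S - Q is used below. *)
Lemma secant_slopes xr yr xs ys : on (Some (xr, yr)) -> xs != xq ->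
  ec_add E Q (Some (xr, yr)) = Some (xs, ys) ->
  [/\ slope E xq yq xr yr = - (ys + yq) / (xs - xq),
      xr = slope E xq yq xr yr ^+ 2 - xq - xs &
      slope E xq yq xs ys = (ys - yq) / (xs - xq)].
Proof.
move=> onR xsq; have [opp|nopp] := boolP ((xq == xr) && (yq == - yr)).
  by rewrite /ec_add opp.
rewrite ec_addE // => -[xsE ysE]; have d0 : xs - xq != 0 by rewrite subr_eq0.
split.
- apply: (mulIf d0); rewrite divfK // -ysE xsE line_horner; ring.
- by rewrite -xsE /third_x; ring.
by rewrite /slope eq_sym (negPf xsq).
Qed.

(** With R = S - Q and T = S + Q, the product (x_Q - x_T)(x_Q - x_R) is symmetric
    under S -> -S, hence a rational function of x_S. *)
Lemma x_recurrence xr yr xs ys xt yt : on (Some (xr, yr)) -> on (Some (xs, ys)) ->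
  xs != xq ->
  ec_add E Q (Some (xr, yr)) = Some (xs, ys) ->
  ec_add E Q (Some (xs, ys)) = Some (xt, yt) ->
  (xq - xt) * (xq - xr) * (xq - xs) ^+ 2 = psi 2 ^+ 2 * (xq - xs) - psi 3.
Proof.
move=> onR onS xsq eS eT; have [e1 e2 e3] := secant_slopes onR xsq eS.
have d0 : xs - xq != 0 by rewrite subr_eq0.
have {eT} xtE : xt = slope E xq yq xs ys ^+ 2 - xq - xs.
  move: eT; rewrite ec_addE; first by case.
  by rewrite eq_sym (negPf xsq).
rewrite xtE e2 e3 e1.
have [_ [_ [[psi2 psi3 _] _]]] := netW.
rewrite {1}/psi psi2 /psi psi3.
move: onQ onS; rewrite /on_curve => /eqP eq /eqP es.
have B : wB E = yq ^+ 2 - xq ^+ 3 - wA E * xq by rewrite eq; ring.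
have A : wA E = (ys ^+ 2 - yq ^+ 2 - xs ^+ 3 + xq ^+ 3) / (xs - xq).
  by apply: (mulIf d0); rewrite divfK // es eq; ring.
by rewrite B A; field.
Qed.

Lemma x_double x2 y2 : ec_add E Q Q = Some (x2, y2) ->
  (xq - x2) * psi 2 ^+ 2 = psi 3.
Proof.
have [_ [_ [[psi2 psi3 _] _]]] := netW.
rewrite ec_addE; last by rewrite eqxx -subr_eq0 opprK -mulr2n -mulr_natl mulf_eq0 negb_or two_neq0.
case=> <- _; rewrite /third_x /slope eqxx /psi psi2 psi3.
move: onQ; rewrite /on_curve => /eqP eq.
have -> : wB E = yq ^+ 2 - xq ^+ 3 - wA E * xq by rewrite eq; ring.
by field; rewrite yq_neq0.
Qed.

Lemma x_triple x2 y2 x3 y3 : ec_add E Q Q = Some (x2, y2) -> x2 != xq ->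
  ec_add E Q (Some (x2, y2)) = Some (x3, y3) ->
  (xq - x3) * psi 3 ^+ 2 = psi 4 * psi 2.
Proof.
move=> e2 x2q e3; have h2 := x_double e2.
have [_ [_ [[psi2 psi3 psi4] _]]] := netW.
have d0 : xq - x2 != 0 by rewrite subr_eq0 eq_sym.
have d0' : x2 - xq != 0 by rewrite subr_eq0.
have [s1 s2 s3] := secant_slopes onQ x2q e2.
have x3E : x3 = slope E xq yq x2 y2 ^+ 2 - xq - x2.
  move: e3; rewrite ec_addE; first by case.
  by rewrite eq_sym (negPf x2q).
have l0 : slope E xq yq xq yq = (3 * xq ^+ 2 + wA E) / (2 * yq) by rewrite /slope eqxx.
have y2E : y2 = - yq - slope E xq yq xq yq * (x2 - xq).
  by rewrite s1 divfK //; ring.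
rewrite x3E s3 y2E -h2.
set m := slope _ _ _ _ _ in s2 l0 *.
have x2E : x2 = m ^+ 2 - 2 * xq.
  transitivity (m ^+ 2 - xq - (m ^+ 2 - xq - x2)); first by ring.
  by rewrite -s2; ring.
have A : wA E = m * (2 * yq) - 3 * xq ^+ 2 by rewrite l0 divfK ?mulf_neq0 //; ring.
move: onQ; rewrite /on_curve => /eqP eq.
have B : wB E = yq ^+ 2 - xq ^+ 3 - wA E * xq by rewrite eq; ring.
rewrite /psi psi4 psi2 B A.
move: d0'; rewrite x2E => d0'.
by field.
Qed.

Variable M : nat.
Hypothesis mulQ : forall i, (1 < i)%N -> (i <= M)%N ->
  exists xs ys, ec_muln E Q i = Some (xs, ys) /\ xs != xq.

Lemma mulQ1 : ec_muln E Q 1 = Q. Proof. by []. Qed.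
Lemma mulQS n : ec_muln E Q n.+1 = ec_add E Q (ec_muln E Q n). Proof. by []. Qed.

Lemma psi1 : psi 1 = 1. Proof. by have [_ [[]]] := netW. Qed.
Lemma psi2 : psi 2 = 2 * yq. Proof. by have [_ [_ [[]]]] := netW. Qed.
Lemma psi0 : psi 0 = 0. Proof. by case: netW => -[]. Qed.

(** The general step starts at n = 4: for n = 3 the recurrence would divide by
    x_Q - x_Q = 0, and the formula for x_[3]Q is needed instead. *)
Lemma psi_neq0_x n : (0 < n)%N -> (n <= M)%N ->
  [/\ psi n != 0, psi n.+1 != 0 & forall xs ys, ec_muln E Q n = Some (xs, ys) ->
    (xq - xs) * psi n ^+ 2 = psi n.+1 * psi n.-1].
Proof.
have psi2_neq0 : psi 2 != 0 by rewrite psi2 mulf_neq0.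
elim/ltn_ind: n => -[//|[|[|[|n]]]] IH _ hn.
- rewrite psi1 oner_neq0; split=> // xs ys; rewrite mulQ1 => -[<- _].
  by rewrite subrr mul0r psi0 mulr0.
- have [xs [ys [e xsq]]] := @mulQ 2 isT hn.
  have h := x_double e; split=> //.
    by rewrite -h mulf_neq0 ?expf_neq0 // subr_eq0 eq_sym.
  by move=> xs' ys'; rewrite e => -[<- _]; rewrite h psi1 mulr1.
- have [_ psi3_neq0 _] := IH 2 isT isT (ltnW hn).
  have [x2 [y2 [e2 x2q]]] := @mulQ 2 isT (ltnW hn).
  have [xs [ys [e xsq]]] := @mulQ 3 isT hn.
  have /(_ xs ys) := x_triple e2 x2q; rewrite -e2 -mulQS => /(_ e) h; split=> //.
    apply: contra_neq (xsq) => p0; move: h; rewrite p0 mul0r => /eqP.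
    by rewrite mulf_eq0 expf_eq0 (negPf psi3_neq0) orbF subr_eq0 eq_sym => /eqP.
  by move=> xs' ys'; rewrite e => -[<- _].
have hn3 := ltnW hn; have hn2 := ltnW hn3.
have [pn2 pn3 xn2] := IH n.+2 (leqnSn _) isT hn2.
have [_ pn4 xn3] := IH n.+3 (leqnn _) isT hn3.
have [pn1 _ _] := IH n.+1 (ltnW (leqnSn _)) isT (ltnW hn2).
have [xr [yr [er xrq]]] := @mulQ n.+2 isT hn2.
have [xs [ys [es xsq]]] := @mulQ n.+3 isT hn3.
have [xt [yt [et xtq]]] := @mulQ n.+4 isT hn.
have onr := on_ec_muln two_neq0 n.+2 onQ; rewrite er in onr.
have ons := on_ec_muln two_neq0 n.+3 onQ; rewrite es in ons.
have := x_recurrence onr ons xsq; rewrite -er -es -!mulQS => /(_ _ _ erefl et) h.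
have key := division_value_step pn1 pn3 h (xn3 _ _ es) (xn2 _ _ er) (psi_rec n.+1).
split=> //; last by move=> xs' ys'; rewrite et => -[<- _].
apply: contra_neq (xtq) => p0; move: key; rewrite p0 mul0r => /eqP.
by rewrite mulf_eq0 expf_eq0 (negPf pn4) orbF subr_eq0 eq_sym => /eqP.
Qed.

Hypothesis onP : on P.
Hypothesis P_neq : forall i xs ys, (0 < i)%N -> (i <= M)%N ->
  ec_muln E Q i = Some (xs, ys) -> xp != xs.

Definition line_val (S : ecpoint F) : F :=
  if S is Some (xs, ys) then yp - (line E xq yq xs ys).[xp] else 1.

Lemma line_val_mul xs ys xt yt : on (Some (xs, ys)) ->
  ec_add E Q (Some (xs, ys)) = Some (xt, yt) ->
  line_val (Some (xs, ys)) * (- yp - (line E xq yq xs ys).[xp]) =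
  - ((xp - xq) * (xp - xs) * (xp - xt)).
Proof.
move=> onS; have [opp|nopp] := boolP ((xq == xs) && (yq == - ys)).
  by rewrite /ec_add opp.
rewrite ec_addE // => -[<- _]; rewrite /line_val.
have := horner_cubic_sub_line two_neq0 onQ onS nopp xp => <-.
by move: onP; rewrite /on_curve -cubic_horner => /eqP <-; ring.
Qed.

(** The induction compares the chord through Q and [n+1]Q at P with the chord
    through Q and [n]Q at -P: the sum of their slopes is 2 y_Q / (x_Q - x_[n+1]Q),
    and the product of the latter with the chord through Q and [n]Q at P is known
    from [line_val_mul]. *)
Lemma phi_step n : (0 < n)%N -> (n < M)%N -> forall xs ys,
  ec_muln E Q n = Some (xs, ys) ->
  phi n.+1 * psi n * (xp - xq) * (xp - xs) = phi n * psi n.+1 * line_val (Some (xs, ys)).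
Proof.
have M1 : (1 < M)%N -> xp - xq != 0.
  by move=> h; rewrite subr_eq0; apply: (@P_neq 1 _ _ isT (ltnW h) mulQ1).
case: n => // n _; elim: n => [|n IH] hn xt yt.
  rewrite mulQ1 => -[<- <-].
  have [_ [[_ _ W11] [_ [W21 _ _]]]] := netW.
  rewrite psi1 psi2 /phi W11 W21 /line_val line_horner /slope eqxx.
  have d0 := M1 hn.
  move: onQ onP; rewrite /on_curve => /eqP eq /eqP ep.
  have B : wB E = yq ^+ 2 - xq ^+ 3 - wA E * xq by rewrite eq; ring.
  have A : wA E = (yp ^+ 2 - yq ^+ 2 - xp ^+ 3 + xq ^+ 3) / (xp - xq).
    by apply: (mulIf d0); rewrite divfK // ep eq; ring.
  by rewrite A; field; rewrite two_neq0 yq_neq0.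
have hn1 := ltnW hn.
have d0 : xp - xq != 0 by apply: M1; apply: leq_trans hn.
have [xr [yr er]] : exists xr yr, ec_muln E Q n.+1 = Some (xr, yr).
  case: (n) hn1 => [|j] hj; first by exists xq, yq.
  by have [a [b [e _]]] := @mulQ j.+2 isT (ltnW hj); exists a, b.
have [xs [ys [es xsq]]] := @mulQ n.+2 isT (ltnW hn).
rewrite es => -[<- <-] {xt yt}.
have onr := on_ec_muln two_neq0 n.+1 onQ; rewrite er in onr.
have es' : ec_add E Q (Some (xr, yr)) = Some (xs, ys) by rewrite -er.
have [s1 _ s3] := secant_slopes onr xsq es'.
have lv := line_val_mul onr es'.
have [pn _ _] := psi_neq0_x (isT : (0 < n.+1)%N) (ltnW hn1).
have [_ _ /(_ _ _ es) xn] := psi_neq0_x (isT : (0 < n.+2)%N) (ltnW hn).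
have ln0 : line_val (Some (xr, yr)) != 0.
  have : - ((xp - xq) * (xp - xr) * (xp - xs)) != 0.
    rewrite oppr_eq0 !mulf_neq0 // subr_eq0.
      exact: (P_neq _ (ltnW hn1) er).
    exact: (P_neq _ (ltnW hn) es).
  by rewrite -lv mulf_eq0 negb_or => /andP[].
apply: (net_step pn ln0 (IH hn1 _ _ er) (phi_rec n.+1) lv _ xn).
rewrite /line_val !line_horner s1 s3 psi2.
have ds0 : xs - xq != 0 by rewrite subr_eq0.
by field.
Qed.

Lemma phi_neg_mul n xs ys : (0 < n)%N -> (n <= M)%N -> ec_muln E Q n = Some (xs, ys) ->
  phi n * W (- n%:Z, 1) = - (psi n ^+ 2 * (xp - xs)).
Proof.
case: n => // n _ hn en; rewrite phi_neg.
have [_ _ /(_ _ _ en) /= <-] := psi_neq0_x (isT : (0 < n.+1)%N) hn.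
by ring.
Qed.

End Net.

(** * Multiples of a point of odd prime order *)

Section Multiples.
Variables (F : fieldType) (E : weierstrass F) (Q : ecpoint F).
Local Notation mul := (ec_muln E Q).

Lemma ec_muln_period m n : mul n = None -> mul (m + n) = mul m.
Proof. by rewrite /ec_muln iterD => ->. Qed.

Lemma ec_muln_multiple m n : mul n = None -> mul (m * n) = None.
Proof. by move=> h; elim: m => // m IH; rewrite mulSn addnC ec_muln_period // . Qed.

Lemma ec_muln1 : mul 1 = Q. Proof. by case: (Q) => [[]|]. Qed.

(** The indices n with [n]Q = O are closed under the Euclidean algorithm, because
    the sequence of iterates restarts at O. *)
Lemma ec_muln_prime_neq0 r i : prime r -> mul r = None -> Q != None ->
  (0 < i < r)%N -> mul i != None.
Proof.
move=> pr hr Q0 /andP[i0 ir]; apply: contraNneq Q0 => hi.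
have /coprimeP : coprime i r.
  by rewrite coprime_sym prime_coprime // gtnNdvd.
move=> /(_ i0)[[a b] /= ab].
have e : (a * i = 1 + b * r)%N by lia.
by rewrite -ec_muln1 -(ec_muln_period 1 (ec_muln_multiple b hr)) -e ec_muln_multiple.
Qed.

End Multiples.

Section OddOrder.
Variables (F : fieldType) (E : weierstrass F) (xq yq : F) (r : nat).
Local Notation Q := (Some (xq, yq)).
Hypothesis two_neq0 : (2 : F) != 0.
Hypothesis onQ : on_curve E Q.
Hypothesis r_prime : prime r.
Hypothesis r_gt2 : (2 < r)%N.
Hypothesis rQ : ec_muln E Q r = None.

Lemma mulQ_neq0 i : (0 < i < r)%N -> ec_muln E Q i != None.
Proof. exact: ec_muln_prime_neq0. Qed.

Lemma yq_neq0 : yq != 0.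
Proof.
have := @mulQ_neq0 2 r_gt2; apply: contra_neq => y0.
by rewrite /ec_muln /= y0 oppr0 !eqxx.
Qed.

(** If [i]Q = -Q then [i+1]Q = O; if [i]Q = Q then Q + [i-1]Q = Q with
    [i-1]Q <> O, and the addition formula forces y_Q = 0. *)
Lemma x_muln_neq i : (1 < i)%N -> (i.+1 < r)%N ->
  exists xs ys, ec_muln E Q i = Some (xs, ys) /\ xs != xq.
Proof.
move=> i1 ir; have i0 : ec_muln E Q i != None by apply: mulQ_neq0; lia.
have i10 : ec_muln E Q i.+1 != None by apply: mulQ_neq0; lia.
have i20 : ec_muln E Q i.-1 != None by apply: mulQ_neq0; lia.
have oni := on_ec_muln two_neq0 i onQ.
case e : (ec_muln E Q i) i0 oni i10 => [[xs ys]|//] _ oni; rewrite mulQS e.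
move=> i10; exists xs, ys; split=> //; apply/eqP => xsE; subst xs.
have : (ys == yq) || (ys == - yq).
  by move: onQ oni; rewrite /on_curve -eqf_sqr => /eqP -> /eqP ->.
case/orP => /eqP ysE; subst ys; last by rewrite /= opprK !eqxx in i10.
case: i i1 e i20 {ir i10 oni} => // i _; rewrite mulQS [_.-1]/=.
have := on_ec_muln two_neq0 i onQ.
case: (ec_muln E Q i) => [[xr yr]|//] onr; have [opp|nopp] := boolP ((xq == xr) && (yq == - yr)).
  by rewrite /ec_add opp.
rewrite ec_addE // => -[e1 e2] _; move: e2; rewrite e1 line_horner subrr mulr0 addr0.
move/eqP; rewrite eq_sym -subr_eq0 opprK -mulr2n -mulr_natl mulf_eq0 (negPf two_neq0) /=.
by rewrite (negPf yq_neq0).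
Qed.

End OddOrder.

(** * Sextic twists *)

Section Twist.
Variables (F : fieldType) (b theta : F).
Local Notation E := (Weierstrass 0 b).
Local Notation E' := (twist_curve b theta).
Local Notation tw := (twist_map theta).
Hypothesis theta_neq0 : theta != 0.
Hypothesis two_neq0 : (2 : F) != 0.

Lemma twist_slope x1 y1 x2 y2 :
  slope E (x1 * theta ^+ 2) (y1 * theta ^+ 3) (x2 * theta ^+ 2) (y2 * theta ^+ 3)
  = theta * slope E' x1 y1 x2 y2.
Proof.
rewrite /slope (inj_eq (mulIf (expf_neq0 2 theta_neq0))) /= !addr0.
have [_|x12] := eqVneq x1 x2.
  have [->|y10] := eqVneq y1 0; first by rewrite mul0r !mulr0 invr0 !mulr0.
  by field; rewrite y10 theta_neq0 two_neq0.
have d0 : x2 - x1 != 0 by rewrite subr_eq0 eq_sym.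
by rewrite -!mulrBl; field; rewrite d0 theta_neq0.
Qed.

Lemma twist_ec_add S T : tw (ec_add E' S T) = ec_add E (tw S) (tw T).
Proof.
case: S T => [[x1 y1]|] [[x2 y2]|] //=.
rewrite -mulNr !(inj_eq (mulIf (expf_neq0 _ theta_neq0))).
case: ifP => // _; have := twist_slope x1 y1 x2 y2.
rewrite /slope (inj_eq (mulIf (expf_neq0 2 theta_neq0))) /= => ->.
by congr (Some (_, _)); ring.
Qed.

Lemma twist_ec_muln T n : tw (ec_muln E' T n) = ec_muln E (tw T) n.
Proof. by elim: n => //= n IH; rewrite -IH; apply: twist_ec_add. Qed.

Lemma twist_on_curve T : on_curve E (tw T) = on_curve E' T.
Proof.
case: T => [[x0 y0]|] //=; rewrite !mul0r !addr0.
have t6 : theta ^+ 6 != 0 by rewrite expf_neq0.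
rewrite -[in RHS](inj_eq (mulIf t6)) mulrDl divfK //.
by congr (_ == _); ring.
Qed.

Lemma twist_step_val xq yq xs ys xt yt xp yp :
  ec_add E' (Some (xq, yq)) (Some (xs, ys)) = Some (xt, yt) ->
  step_val E (tw (Some (xq, yq))) (tw (Some (xs, ys))) (tw (Some (xp, yp))) =
  (theta ^+ 3 * line_val E' xq yq xp yp (Some (xs, ys))) / (theta ^+ 2 * (xp - xt)).
Proof.
move=> e; have := twist_ec_add (Some (xq, yq)) (Some (xs, ys)).
rewrite e /twist_map /step_val => <-; rewrite /line_val !line_horner twist_slope.
by congr (_ / _); ring.
Qed.

End Twist.

(** * Finite subfields *)

Section Subfields.
Variables (F : fieldType) (p : nat).
Hypothesis pF : p \in [pchar F].

Lemma pchar_nat_exp m : [pchar F].-nat (p ^ m)%N.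
Proof. by rewrite pnatX pnatE ?pF // (pcharf_prime pF). Qed.

Lemma in_FqD m (z w : F) : in_Fq (p ^ m) z -> in_Fq (p ^ m) w -> in_Fq (p ^ m) (z + w).
Proof. by rewrite /in_Fq => hz hw; rewrite exprDn_pchar ?pchar_nat_exp ?hz ?hw. Qed.

Lemma in_FqN m (z : F) : in_Fq (p ^ m) z -> in_Fq (p ^ m) (- z).
Proof. by rewrite /in_Fq => hz; rewrite exprNn_pchar ?pchar_nat_exp ?hz. Qed.

Lemma in_FqM q (z w : F) : in_Fq q z -> in_Fq q w -> in_Fq q (z * w : F).
Proof. by rewrite /in_Fq exprMn => -> ->. Qed.

Lemma in_FqV q (z : F) : in_Fq q z -> in_Fq q (z^-1 : F).
Proof. by rewrite /in_Fq exprVn => ->. Qed.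

Lemma in_FqX q (z : F) n : in_Fq q z -> in_Fq q (z ^+ n : F).
Proof. by rewrite /in_Fq -exprM mulnC exprM => ->. Qed.

Lemma in_Fq1 q : in_Fq q (1 : F). Proof. by rewrite /in_Fq expr1n. Qed.

Lemma in_Fq0 m : in_Fq (p ^ m) (0 : F).
Proof. by rewrite /in_Fq expr0n expn_eq0 -[p == 0%N]negbK -lt0n prime_gt0 ?(pcharf_prime pF). Qed.

Lemma in_Fq_mul m n (z : F) : in_Fq (p ^ m) z -> in_Fq (p ^ (m * n)) (z : F).
Proof.
by move=> hz; rewrite /in_Fq; elim: n => [|n IH]; rewrite ?muln0 ?expr1 // mulnS expnD exprM hz.
Qed.

Lemma in_Fq_nat m n : in_Fq (p ^ m) (n%:R : F).
Proof.
elim: n => [|n IH]; first exact: in_Fq0.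
by rewrite -natr1; apply: in_FqD IH (in_Fq1 _).
Qed.

Lemma in_Fq_ec_add m (E : weierstrass F) S T : in_Fq (p ^ m) (wA E) ->
  rational_point (p ^ m) S -> rational_point (p ^ m) T ->
  rational_point (p ^ m) (ec_add E S T).
Proof.
move=> hA; case: S T => [[x1 y1]|] [[x2 y2]|] // [hx1 hy1] [hx2 hy2].
have [opp|nopp] := boolP ((x1 == x2) && (y1 == - y2)); first by rewrite /ec_add opp.
have hl : in_Fq (p ^ m) (slope E x1 y1 x2 y2).
  rewrite /slope; case: ifP => _; apply: in_FqM.
  - by apply: in_FqD hA; apply: in_FqM (in_FqX 2 hx1); apply: in_Fq_nat.
  - by apply/in_FqV/in_FqM => //; apply: in_Fq_nat.
  - by apply: in_FqD => //; apply: in_FqN.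
  by apply/in_FqV/in_FqD => //; apply: in_FqN.
have hx3 : in_Fq (p ^ m) (third_x E x1 y1 x2 y2).
  apply: in_FqD (in_FqN hx2); apply: in_FqD (in_FqN hx1); exact: in_FqX.
rewrite ec_addE //; split=> //; apply: in_FqN; rewrite line_horner.
by apply: in_FqD => //; apply: in_FqM => //; apply: in_FqD => //; apply: in_FqN.
Qed.

Lemma in_Fq_ec_muln m (E : weierstrass F) T n : in_Fq (p ^ m) (wA E) ->
  rational_point (p ^ m) T -> rational_point (p ^ m) (ec_muln E T n).
Proof. by move=> hA hT; elim: n => //= n IH; apply: in_Fq_ec_add. Qed.

End Subfields.

(** * Arithmetic of the parameters *)

Lemma sqr_mod3 (a : int) : (exists v, a = 3 * v) -> exists v, a ^+ 2 = 3 * v.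
Proof. by move=> [v ->]; exists (3 * v ^+ 2); ring. Qed.

Lemma sqr_mod3_1 (a : int) : (exists v, a = 3 * v + 1) -> exists v, a ^+ 2 = 3 * v + 1.
Proof. by move=> [v ->]; exists (3 * v ^+ 2 + 2 * v); ring. Qed.

(** The three families share the shape w^2 - w + 1, with w = u^2, u^4, u^8. *)
Lemma bls_rP k u : k \in [:: 12; 24; 48] -> exists j, [/\ (0 < j)%N &
  let w := iter j (fun a => a ^+ 2) u in bls_r k u = w ^+ 2 - w + 1].
Proof.
rewrite !inE => /or3P[] /eqP->; [exists 1%N | exists 2%N | exists 3%N];
  by split=> //=; ring.
Qed.

Lemma mod3P (a : int) : exists v, [\/ a = 3 * v, a = 3 * v + 1 | a = 3 * v + 2].
Proof.
exists (a %/ 3)%Z; have := divz_eq a 3; have := modz_ge0 a (isT : (3 : int) != 0).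
have := ltz_pmod a (isT : (0 : int) < 3).
move: (a %/ 3)%Z (a %% 3)%Z => q s s3 s0 e.
have [s00|[s1|s2]] : s = 0 \/ s = 1 \/ s = 2 by lia.
- by apply: Or31; lia.
- by apply: Or32; lia.
by apply: Or33; lia.
Qed.

(** As w is 0 or 1 modulo 3, r is 1 modulo 3; so 3 divides (u - 1)^2, whence
    u = 1 modulo 3, and then 9 divides (u - 1)^2 r = 3 (p - u). *)
Lemma bls_mod3 k u (p r : int) : k \in [:: 12; 24; 48] -> r = bls_r k u ->
  3 * (p - u) = (u - 1) ^+ 2 * r -> exists v, p = 3 * v + 1.
Proof.
move=> /(bls_rP u)[j [j0 /= rE]] re; rewrite -re {re} in rE => e.
have [v uE] := mod3P u.
have w3 : (exists w', iter j (fun a => a ^+ 2) u = 3 * w') \/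
    (exists w', iter j (fun a => a ^+ 2) u = 3 * w' + 1).
  case: uE => uE; [left|right|right].
  + by elim: j {j0 rE} => [|j IH]; [exists v | apply: sqr_mod3].
  + by elim: j {j0 rE} => [|j IH]; [exists v | apply: sqr_mod3_1].
  case: j j0 {rE} => // j _; elim: j => [|j IH]; last exact: sqr_mod3_1.
  by exists (3 * v ^+ 2 + 4 * v + 1); rewrite uE /=; ring.
have [s rs] : exists s, r = 3 * s + 1.
  case: w3 => -[w' wE]; rewrite rE wE.
    by exists (3 * w' ^+ 2 - w'); ring.
  by exists (3 * w' ^+ 2 + w'); ring.
case: uE e => ->; rewrite rs => e.
- have : 3 * (p - 3 * v) = 3 * ((3 * v ^+ 2 - 2 * v) * (3 * s + 1) + s) + 1 by rewrite e; ring.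
  by move: ((_ - _) * _) => X; lia.
- have : 3 * (p - (3 * v + 1)) = 3 * (3 * (v ^+ 2 * (3 * s + 1))) by rewrite e; ring.
  by move: (v ^+ 2 * _) => X h; exists (v + X); lia.
have : 3 * (p - (3 * v + 2)) = 3 * ((3 * v ^+ 2 + 2 * v) * (3 * s + 1) + s) + 1 by rewrite e; ring.
by move: ((_ + _) * _) => X; lia.
Qed.

Lemma bls_r_bounds k u (r : nat) : k \in [:: 12; 24; 48] -> r%:Z = bls_r k u ->
  prime r -> [/\ (1 < `|u|)%N, (`|u|.+2 < r)%N & odd r].
Proof.
move=> /(bls_rP u)[j [j0 /= rE]] re pr; rewrite -re {re} in rE.
have [u1|u2] := leqP `|u|%N 1.
  have w01 : iter j (fun a => a ^+ 2) u = 0 \/ iter j (fun a => a ^+ 2) u = 1.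
    case: j j0 {rE} => // j _; elim: j => [|j [IH|IH]].
    - have [->|[->|->]] : u = 0 \/ u = 1 \/ u = -1 by lia.
      + by left; rewrite /= expr0n.
      + by right; rewrite /= expr1n.
      by right; rewrite /= sqrrN expr1n.
    - by left; rewrite iterS IH expr0n.
    by right; rewrite iterS IH expr1n.
  have r1 : r = 1%N by case: w01 => w01; move: rE; rewrite w01 ?expr0n ?expr1n /=; lia.
  by rewrite r1 in pr.
have uw : u ^+ 2 <= iter j (fun a => a ^+ 2) u.
  case: j j0 {rE} => // j _; elim: j => [|j IH] //.
  by rewrite iterS; move: (iter _ _ _) IH => w; nia.
move: (iter _ _ _) uw rE => w uw rE.
have [z wz] : exists z, w = 2 * z \/ w = 2 * z + 1.
  exists (w %/ 2)%Z; have := divz_eq w 2; have := modz_ge0 w (isT : (2 : int) != 0).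
  have := ltz_pmod w (isT : (0 : int) < 2).
  by move: (w %/ 2)%Z (w %% 2)%Z => q s; lia.
have [X rX] : exists X : int, r%:Z = 2 * X + 1.
  by rewrite rE; case: wz => ->; [exists (2 * z ^+ 2 - z) | exists (2 * z ^+ 2 + z)]; ring.
have w4 : 4 <= u ^+ 2 by nia.
have uu : 2 * `|u|%N%:Z <= u ^+ 2 by nia.
have rw : 3 * w + 1 <= r%:Z by rewrite rE; nia.
split=> //; first by lia.
by lia.
Qed.

Lemma subn1_cube q : (0 < q)%N -> (q ^ 3 - 1 = (q - 1) * (q ^ 2 + q + 1))%N.
Proof.
case: q => // a _; rewrite subSS subn0; apply: (@addIn 1).
by rewrite subnK ?expn_gt0 // -addn1; ring.
Qed.

Lemma dvd3_cyclotomic q : q = 1 %[mod 3] -> (3 %| q ^ 2 + q + 1)%N.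
Proof.
move=> q1; rewrite (divn_eq q 3) q1 modn_small //; move: (q %/ 3)%N => d.
by apply/dvdnP; exists (3 * d ^ 2 + 3 * d + 1)%N; ring.
Qed.

(** By minimality of the embedding degree r does not divide q^3 - 1 = p^(k/2) - 1,
    so it divides q^3 + 1; the latter is even and r is odd, so (q^3 + 1)/r is
    even.  The second divisibility comes from 3 | q^2 + q + 1. *)
Lemma bls_final_exponent k (p r : nat) (h : embedding_degree p r k) : k \in [:: 12; 24; 48] ->
  odd p -> odd r -> prime r -> p = 1 %[mod 3] ->
  let q := (p ^ (k %/ 6))%N in
  [/\ (2 * (q ^ 3 - 1) %| (p ^ k - 1) %/ r)%N, (6 * (q - 1) %| 2 * (q ^ 3 - 1))%N & (0 < q)%N].
Proof.
move=> hk op or pr p1 q; case: h => k0 rk emb.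
have kE : k = (6 * (k %/ 6))%N by move: hk; rewrite !inE => /or3P[] /eqP->.
have pk : (p ^ k = (q ^ 3) ^ 2)%N by rewrite /q -!expnM; congr (_ ^ _)%N; rewrite {1}kE; lia.
have q0 : (0 < q)%N by rewrite expn_gt0; case: (p) op.
have oq : odd (q ^ 3) by rewrite !oddX op !orbT.
have q30 : (0 < q ^ 3)%N by rewrite expn_gt0 q0.
have fact : (p ^ k - 1 = (q ^ 3 - 1) * (q ^ 3 + 1))%N.
  by rewrite pk -[X in (_ - X)%N = _](exp1n 2) subn_sqr.
have nr : ~~ (r %| q ^ 3 - 1)%N.
  have -> : (q ^ 3 = p ^ (3 * (k %/ 6)))%N by rewrite /q -expnM mulnC.
  by apply: emb; move: hk; rewrite !inE => /or3P[] /eqP->.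
have rq : (r %| q ^ 3 + 1)%N by move: rk; rewrite fact Euclid_dvdM // (negPf nr).
have q1 : q = 1 %[mod 3] by rewrite /q -modnXm p1 modnXm exp1n.
split=> //.
  rewrite fact -muln_divA // mulnC; apply: dvdn_mul => //.
  have /dvdnP[h hE] := rq; rewrite hE mulnK ?prime_gt0 //.
  have : ~~ odd (h * r) by rewrite -hE oddD oq.
  by rewrite oddM or andbT dvdn2.
have -> : (q ^ 3 - 1 = (q - 1) * (q ^ 2 + q + 1))%N.
  exact: subn1_cube.
have -> : (6 * (q - 1) = 2 * ((q - 1) * 3))%N by lia.
rewrite dvdn_pmul2l //; apply: dvdn_mul => //.
exact: dvd3_cyclotomic.
Qed.

Lemma frob_eigen1_rational (F : fieldType) (E : weierstrass F) p r P :
  in_G1 E p r P -> rational_point p P.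
Proof.
case: P => [[xP yP]|//] [_ _]; rewrite /= opprK.
by case: ifP => // /andP[/eqP hx /eqP hy] _; split.
Qed.

Lemma absz_cases (u : int) : u = `|u|%N%:Z \/ u = - `|u|%N%:Z.
Proof. by lia. Qed.

(** * The final exponentiation *)

Section FinalExponentiation.
Variables (F : fieldType) (b theta : F) (k : nat) (u : int) (p r : nat).
Variables (xq yq xp yp : F) (W : int * int -> F).
Hypothesis F_closed : forall q : {poly F}, size q != 1 -> exists x, root q x.
Hypothesis pF : p \in [pchar F].
Hypothesis p_gt3 : (3 < p)%N.
Hypothesis b_neq0 : b != 0.
Hypothesis kP : k \in [:: 12; 24; 48].
Hypothesis r_prime : prime r.
Hypothesis rE : r%:Z = bls_r k u.
Hypothesis pE : 3 * (p%:Z - u) = (u - 1) ^+ 2 * r%:Z.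
Hypothesis emb : embedding_degree p r k.
Local Notation E := (Weierstrass 0 b).
Local Notation E' := (twist_curve b theta).
Local Notation tw := (twist_map theta).
Local Notation Qt := (Some (xq, yq)).
Local Notation Pt := (Some (xp, yp)).
Hypothesis hP : in_G1 E p r (tw Pt).
Hypothesis hQ : in_G2 E p r (tw Qt).
Hypothesis htheta : is_sextic_twist b p r k theta.
Hypothesis hPt : on_curve E' Pt.
Hypothesis hQt : on_curve E' Qt.
Hypothesis hW : is_net_of E' Qt Pt W.

Let q := (p ^ (k %/ 6))%N.
Let N := ((p ^ k - 1) %/ r)%N.
Let M := `|u|%N.

Lemma two_neq0 : (2 : F) != 0.
Proof.
rewrite -(dvdn_pcharf pF) gtnNdvd //; lia.
Qed.

Lemma three_neq0 : (3 : F) != 0.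
Proof. by rewrite -(dvdn_pcharf pF) gtnNdvd. Qed.

Lemma nonsingular_E : nonsingular E.
Proof.
rewrite /nonsingular /= expr0n mulr0 add0r -[27]/((3 ^ 3)%:R) natrX.
by rewrite mulf_neq0 ?expf_neq0 ?three_neq0.
Qed.

Lemma theta_neq0 : theta != 0. Proof. by case: htheta. Qed.

Lemma p_mod3 : p = 1 %[mod 3].
Proof. by have [v] := bls_mod3 kP rE pE; lia. Qed.

Lemma odd_p : odd p.
Proof. by case: (even_prime (pcharf_prime pF)) => // p2; move: p_gt3; rewrite p2. Qed.

Lemma exponents : [/\ (2 * (q ^ 3 - 1) %| N)%N, (6 * (q - 1) %| 2 * (q ^ 3 - 1))%N & (0 < q)%N].
Proof.
have [_ _ odd_r] := bls_r_bounds kP rE r_prime.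
exact: bls_final_exponent emb kP odd_p odd_r r_prime p_mod3.
Qed.

Lemma N_gt0 : (0 < N)%N.
Proof.
have [k0 rk _] := emb; rewrite divn_gt0 ?prime_gt0 //; apply: dvdn_leq => //.
by rewrite subn_gt0 -(exp1n k) ltn_exp2r // (ltn_trans _ p_gt3).
Qed.

Lemma in_Fq_expr_subn1 s (z : F) : (0 < s)%N -> z != 0 -> in_Fq s z -> z ^+ (s - 1) = 1.
Proof.
move=> s0 z0 h; apply: (mulIf z0); rewrite mul1r -exprSr subn1 prednK //; exact: h.
Qed.

Lemma expr_dvdn_1 m n (z : F) : (m %| n)%N -> z ^+ m = 1 -> z ^+ n = 1.
Proof. by move=> /dvdnP[d ->] h; rewrite mulnC exprM h expr1n. Qed.

Lemma expN_Fq3 (z : F) : z != 0 -> in_Fq (q ^ 3) z -> z ^+ N = 1.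
Proof.
have [d1 _ q0] := exponents; move=> z0 h.
apply: (expr_dvdn_1 (dvdn_trans (dvdn_mull 2 (dvdnn _)) d1)).
have q30 : (0 < q ^ 3)%N by rewrite expn_gt0 q0.
exact: (in_Fq_expr_subn1 q30 z0 h).
Qed.

Lemma in_Fq_q3 (z : F) : in_Fq q z -> in_Fq (q ^ 3) z.
Proof. by rewrite /q -expnM; apply: in_Fq_mul. Qed.

Lemma expN_Fq (z : F) : z != 0 -> in_Fq q z -> z ^+ N = 1.
Proof. by move=> z0 h; apply: expN_Fq3 => //; apply: in_Fq_q3. Qed.

Lemma theta_exp : theta ^+ (6 * (q - 1)) = 1.
Proof.
have [_ _ q0] := exponents; rewrite exprM; apply: in_Fq_expr_subn1 => //.
  by rewrite expf_neq0 ?theta_neq0.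
by case: htheta.
Qed.

Lemma expN_theta : theta ^+ N = 1.
Proof.
have [d1 d2 _] := exponents.
exact: expr_dvdn_1 (dvdn_trans d2 d1) theta_exp.
Qed.

Lemma theta2_Fq3 : in_Fq (q ^ 3) (theta ^+ 2).
Proof.
have [_ d2 q0] := exponents; have := expr_dvdn_1 d2 theta_exp.
have q30 : (0 < q ^ 3)%N by rewrite expn_gt0 q0.
rewrite exprM => h; rewrite /in_Fq -[in LHS](prednK q30) exprS -subn1 h mulr1.
by [].
Qed.

(** Otherwise theta^j would have two sets of coordinates in the basis of powers
    of theta: itself times theta^0, and theta^j. *)
Lemma theta_exp_notin_Fq j : (0 < j < 6)%N -> ~ in_Fq q (theta ^+ j).
Proof.
move=> /andP[j0 j6] h; have [_ tk _ basis _] := htheta.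
have [c [_ uniq]] := basis _ (in_FqX j tk).
pose c0 : 'rV[F]_6 := theta ^+ j *: delta_mx 0 ord0.
pose cj : 'rV[F]_6 := delta_mx 0 (Ordinal j6).
have e0 : c = c0.
  apply: uniq; split=> [i|].
    rewrite !mxE eqxx /=; case: (i == _); rewrite ?mulr1 ?mulr0 //.
    exact: (in_Fq0 pF).
  rewrite (bigD1 ord0) //= big1 => [|i i0]; first by rewrite !mxE !eqxx /= ?expr0 !mulr1 addr0.
  by rewrite !mxE eqxx (negPf i0) mulr0 mul0r.
have ej : c = cj.
  apply: uniq; split=> [i|].
    rewrite !mxE eqxx /=; case: (i == _); [exact: in_Fq1 | exact: (in_Fq0 pF)].
  rewrite (bigD1 (Ordinal j6)) //= big1 => [|i i0]; first by rewrite !mxE !eqxx mul1r addr0.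
  by rewrite !mxE eqxx (negPf i0) mul0r.
have := congr1 (fun m : 'rV[F]_6 => m 0 (Ordinal j6)) (etrans (esym e0) ej).
rewrite !mxE !eqxx /= (_ : (Ordinal j6 == ord0) = false); last first.
  by apply/negbTE; rewrite -val_eqE /= -lt0n.
by rewrite mulr0 => /eqP; rewrite eq_sym oner_eq0.
Qed.

Lemma Qt_rational : rational_point q Qt.
Proof. by case: htheta => _ _ _ _; apply. Qed.

Lemma mulQ_rational i : rational_point q (ec_muln E' Qt i).
Proof. by apply: (in_Fq_ec_muln pF) Qt_rational; apply: (in_Fq0 pF). Qed.

Lemma xP_Fp : in_Fq p (xp * theta ^+ 2) /\ in_Fq p (yp * theta ^+ 3).
Proof. exact: (frob_eigen1_rational hP). Qed.

Lemma in_Fp_Fq (z : F) : in_Fq p z -> in_Fq q z.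
Proof. by rewrite -{1}[p]expn1 => /(in_Fq_mul (k %/ 6)); rewrite mul1n. Qed.

Lemma mulQ_r : ec_muln E' Qt r = None.
Proof.
have [_ h _] := hQ; have := twist_ec_muln b theta_neq0 two_neq0 Qt r.
by rewrite -[ec_muln E _ r]/(ec_mul E r _) h; case: (ec_muln E' Qt r) => [[]|].
Qed.

Lemma r_bounds : [/\ (1 < M)%N, (M.+2 < r)%N & (2 < r)%N].
Proof. by have [h1 h2 _] := bls_r_bounds kP rE r_prime; split=> //; lia. Qed.

Lemma mulQ_finite i : (0 < i)%N -> (i <= M)%N -> ec_muln E' Qt i != None.
Proof.
have [_ h2 h3] := r_bounds => i0 iM; apply: (mulQ_neq0 r_prime mulQ_r).
by rewrite i0 (leq_ltn_trans iM) // (ltn_trans _ h2).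
Qed.

Lemma yqt_neq0 : yq != 0.
Proof. by have [_ _ h] := r_bounds; apply: (yq_neq0 r_prime h mulQ_r). Qed.

Lemma mulQ_affine i : (1 < i)%N -> (i <= M)%N ->
  exists xs ys, ec_muln E' Qt i = Some (xs, ys) /\ xs != xq.
Proof.
have [_ h2 h3] := r_bounds => i1 iM.
apply: (x_muln_neq two_neq0 hQt r_prime h3 mulQ_r) => //.
by rewrite (leq_ltn_trans _ h2) // ltnS (leq_trans iM).
Qed.

(** If x_P = x_[i]Q on the twist, then P~ is F_q-rational like Q~.  As its
    coordinates are elements of F_p divided by theta^2 and theta^3, which are not in
    F_q, they vanish; but (0, 0) is not on the curve. *)
Lemma xP_neq i xs ys : ec_muln E' Qt i = Some (xs, ys) -> xp != xs.
Proof.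
move=> e; have := mulQ_rational i; rewrite e => -[hx hy].
have := on_ec_muln two_neq0 i hQt; rewrite e => ons.
apply/eqP => xps; have hxp : in_Fq q xp by rewrite xps.
have hyp : in_Fq q yp.
  have : (yp == ys) || (yp == - ys).
    rewrite -eqf_sqr; move: hPt ons; rewrite /on_curve -xps => /eqP -> /eqP ->.
    by [].
  by case/orP => /eqP ->; [|apply: (in_FqN pF)].
have [/in_Fp_Fq hX /in_Fp_Fq hY] := xP_Fp.
have xp0 : xp = 0.
  apply/eqP; apply: contraT => xp0; case: (@theta_exp_notin_Fq 2 isT).
  by rewrite -(mulKf xp0 (theta ^+ 2)); apply: in_FqM hX; apply: in_FqV.
have yp0 : yp = 0.
  apply/eqP; apply: contraT => yp0; case: (@theta_exp_notin_Fq 3 isT).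
  by rewrite -(mulKf yp0 (theta ^+ 3)); apply: in_FqM hY; apply: in_FqV.
move: hPt; rewrite /= xp0 yp0 !expr0n mulr0 !add0r eq_sym mulf_eq0.
by rewrite (negPf b_neq0) invr_eq0 expf_eq0 (negPf theta_neq0).
Qed.

(** The product with theta^2 is x_P - theta^2 x_[i]Q, with x_P in F_p on E,
    x_[i]Q in F_q on the twist and theta^2 in F_{q^3}. *)
Lemma expN_sub_mulQ i xs ys : ec_muln E' Qt i = Some (xs, ys) -> (xp - xs) ^+ N = 1.
Proof.
move=> e; have := mulQ_rational i; rewrite e => -[hx _].
have [hX _] := xP_Fp; have t2 := expf_neq0 2 theta_neq0.
have d0 : xp - xs != 0 by rewrite subr_eq0 (xP_neq e).
have : ((xp - xs) * theta ^+ 2) ^+ N = 1.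
  apply: expN_Fq3; first by rewrite mulf_neq0.
  rewrite mulrBl /q -expnM; apply: (in_FqD pF).
    by rewrite expnM; apply/in_Fq_q3/in_Fp_Fq.
  apply: (in_FqN pF); rewrite expnM; apply: in_FqM theta2_Fq3.
  exact: in_Fq_q3.
by rewrite exprMn exprAC expN_theta expr1n mulr1.
Qed.

(** By [psi_neq0_x], psi_(i+1) is psi_i^2 / psi_(i-1) times an element of F_q^*. *)
Lemma expN_psi i : (0 < i)%N -> (i <= M)%N -> W (i%:Z, 0) ^+ N = 1.
Proof.
have psiP := psi_neq0_x hW hQt two_neq0 yqt_neq0 mulQ_affine.
have [hx hy] := Qt_rational.
elim/ltn_ind: i => -[//|[|[|i]]] IH _ iM.
- by rewrite (psi1 hW) expr1n.
- rewrite (psi2 hW); apply: expN_Fq; first by rewrite mulf_neq0 ?two_neq0 ?yqt_neq0.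
  by apply: in_FqM => //; apply: (in_Fq_nat pF).
have [xs [ys [e xsq]]] := mulQ_affine (isT : (1 < i.+2)%N) (ltnW iM).
have [_ _ /(_ _ _ e) key] := psiP i.+2 isT (ltnW iM).
have /= := congr1 (fun z => z ^+ N) key.
rewrite !exprMn (IH i.+2) ?(ltnW iM) // (IH i.+1) ?(ltnW (ltnW iM)) //.
rewrite !mulr1 => <-; apply: expN_Fq; first by rewrite subr_eq0 eq_sym.
have := mulQ_rational i.+2; rewrite e => -[hxs _].
by apply: (in_FqD pF) => //; apply: (in_FqN pF).
Qed.

(** The product phi_i phi_(-i) is known and nonzero. *)
Lemma phi_neq0 i : (0 < i)%N -> (i <= M)%N -> W (i%:Z, 1) != 0.
Proof.
move=> i0 iM; case e : (ec_muln E' Qt i) (mulQ_finite i0 iM) => [[xs ys]|//] _.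
have [p0 _ _] := psi_neq0_x hW hQt two_neq0 yqt_neq0 mulQ_affine i0 iM.
have := phi_neg_mul hW hQt two_neq0 yqt_neq0 mulQ_affine i0 iM e.
apply: contra_eq_neq => ->; rewrite mul0r eq_sym oppr_eq0.
by rewrite mulf_neq0 ?expf_neq0 // subr_eq0 (xP_neq e).
Qed.

(** A step of the Miller function on E is theta^3 L / (theta^2 (x_P - x_[n+2]Q))
    with L the chord on the twist, and a step of phi is L times factors whose
    N-th power is 1. *)
Lemma expN_miller_val n : (n < M)%N ->
  miller_val E (tw Qt) (tw Pt) n ^+ N = W (n.+1%:Z, 1) ^+ N.
Proof.
elim: n => [|n IH] hn.
  by have [_ [[_ _ ->] _]] := hW; rewrite !expr1n.
rewrite -[miller_val _ _ _ n.+1]/(miller_val E (tw Qt) (tw Pt) n *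
  step_val E (tw Qt) (ec_muln E (tw Qt) n.+1) (tw Pt)) exprMn IH ?(ltnW hn) //.
case e : (ec_muln E' Qt n.+1) (mulQ_finite (isT : (0 < n.+1)%N) (ltnW hn)) => [[xs ys]|//] _.
case e' : (ec_muln E' Qt n.+2) (mulQ_finite (isT : (0 < n.+2)%N) hn) => [[xt yt]|//] _.
have eS : ec_add E' Qt (Some (xs, ys)) = Some (xt, yt) by rewrite -e.
rewrite -(twist_ec_muln b theta_neq0 two_neq0 Qt n.+1) e.
rewrite (twist_step_val theta_neq0 two_neq0 xp yp eS) exprMn exprVn !exprMn.
rewrite (expN_sub_mulQ e') !expN_theta !mulr1 invr1 mulr1 mul1r.
have Pneq : forall i xs ys, (0 < i)%N -> (i <= M)%N ->
  ec_muln E' Qt i = Some (xs, ys) -> xp != xs by move=> ? ? ? _ _; apply: xP_neq.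
have := phi_step hW hQt two_neq0 yqt_neq0 mulQ_affine hPt Pneq (isT : (0 < n.+1)%N) hn e.
move/(congr1 (fun z => z ^+ N)) => /=; rewrite !exprMn (expN_sub_mulQ e).
rewrite (expN_sub_mulQ (erefl : ec_muln E' Qt 1 = Qt)).
by rewrite (expN_psi (isT : (0 < n.+1)%N) (ltnW hn)) (expN_psi (isT : (0 < n.+2)%N) hn) !mulr1.
Qed.

Lemma fun_eval_miller_expN :
  fun_eval (miller E u (tw Qt)) (tw Pt) ^+ N = W (u, 1) ^+ N.
Proof.
have [M1 _ _] := r_bounds; have M0 := ltnW M1.
have onQ : on_curve E (tw Qt) by rewrite twist_on_curve ?theta_neq0.
have onP : on_curve E (tw Pt) by rewrite twist_on_curve ?theta_neq0.
have mulE i := twist_ec_muln b theta_neq0 two_neq0 Qt i.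
have MS : M.-1.+1 = M by rewrite prednK.
have neq0 i : (0 < i <= M.-1.+1)%N -> ec_muln E (tw Qt) i != None.
  rewrite MS => /andP[i0 iM]; rewrite -mulE.
  by case: (ec_muln E' Qt i) (mulQ_finite i0 iM) => [[]|].
have neqx i : (0 < i <= M.-1.+1)%N -> xcoord_neq (tw Pt) (ec_muln E (tw Qt) i).
  rewrite -mulE => _; case e : (ec_muln E' Qt i) => [[xs ys]|//].
  move=> _ _ _ _ [<- _] [<- _].
  by rewrite (inj_eq (mulIf (expf_neq0 2 theta_neq0))) (xP_neq e).
have ltM : (M.-1 < M)%N by rewrite MS.
have valN := expN_miller_val ltM; rewrite MS in valN.
have [uM|uM] : u = M%:Z \/ u = - M%:Z by apply: absz_cases.
  have [m [lead div]] := miller_fun_principal (@fy_sqr _ E) (@polyf_indep _ E) two_neq0 nonsingular_E onQ neq0.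
  rewrite MS -uM in div.
  rewrite (millerE F_closed two_neq0 lead div) uM -valN; congr (_ ^+ _).
  apply: fun_evalE => //.
  exact: (regular_value_miller (@fy_sqr _ E) (@polyf_indep _ E) onP isT neqx).
have val0 : miller_val E (tw Qt) (tw Pt) M.-1 != 0.
  have : W (M%:Z, 1) ^+ N != 0 by rewrite expf_neq0 // phi_neq0.
  by rewrite -valN expf_eq0 N_gt0.
have [m [lead div]] := miller_fun_neg_principal (@fy_sqr _ E) (@polyf_indep _ E) two_neq0 nonsingular_E onQ neq0.
rewrite !MS in lead div; rewrite -uM in div.
have reg := regular_value_miller_neg (@fy_sqr _ E) (@polyf_indep _ E) neq0 onP isT neqx val0.
rewrite (millerE F_closed two_neq0 lead div).
rewrite MS in reg; rewrite (fun_evalE onP reg) -mulE.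
case e : (ec_muln E' Qt M) (mulQ_finite M0 (leqnn M)) => [[xs ys]|//] _.
rewrite /= -mulrBl exprVn !exprMn valN (expN_sub_mulQ e) !expN_theta !mulr1.
have /= := congr1 (fun z => z ^+ N) (phi_neg_mul hW hQt two_neq0 yqt_neq0 mulQ_affine M0 (leqnn M) e).
rewrite -uM -mulN1r !exprMn (expN_sub_mulQ e) (expN_psi M0 (leqnn M)) !mulr1.
have -> : (-1) ^+ N = 1 :> F.
  by apply: expN_Fq; [rewrite oppr_eq0 oner_eq0 | apply: (in_FqN pF); apply: in_Fq1].
by move=> h; apply: (mulfI (expf_neq0 N (phi_neq0 M0 (leqnn M)))); rewrite h mulfV // expf_neq0 // phi_neq0.
Qed.

End FinalExponentiation.

Theorem mainTheorem1
    (k : nat) (u : int) (p r : nat) (b : 'F_p)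
    (hE : is_BLS k u r b)
    (K : closedFieldType) (iota : {rmorphism 'F_p -> K})
    (hK : integralRange iota)
    (P Q : ecpoint K)
    (hP : in_G1 (Weierstrass 0 (iota b)) p r P) (hP0 : P <> None)
    (hQ : in_G2 (Weierstrass 0 (iota b)) p r Q) (hQ0 : Q <> None)
    (theta : K) (htheta : is_sextic_twist (iota b) p r k theta)
    (Pt Qt : ecpoint K)
    (hPt : on_curve (twist_curve (iota b) theta) Pt)
    (hQt : on_curve (twist_curve (iota b) theta) Qt)
    (hPtP : twist_map theta Pt = P) (hQtQ : twist_map theta Qt = Q)
    (W : int * int -> K)
    (hW : is_net_of (twist_curve (iota b) theta) Qt Pt W) :
  let E := Weierstrass 0 (iota b) in
  let N := ((p ^ k - 1) %/ r)%N in
  optimal_ate E p r k u Q P = fun_eval (miller E u Q) P ^+ N /\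
  fun_eval (miller E u Q) P ^+ N = W (u, 1) ^+ N.
Proof.
move=> E N; split; first by [].
case: hE => hk p_prime p_gt3 r_prime rE pE nsb _ _ emb.
have pK : p \in [pchar K] := rmorph_pchar iota (pchar_Fp p_prime).
have b0 : iota b != 0.
  rewrite fmorph_eq0; apply: contraNneq nsb => b0.
  by rewrite /= b0 !expr0n !mulr0 addr0.
have K_closed (q : {poly K}) : size q != 1 -> exists x, root q x.
  by move/closed_rootP.
move: hPt hQt hPtP hQtQ hW; case: Pt => [[xp yp]|_ _ P0]; last by rewrite -P0 in hP0.
case: Qt => [[xq yq]|_ _ _ Q0]; last by rewrite -Q0 in hQ0.
move=> onP onQ eP eQ netW; rewrite -eP -eQ in hP hQ *.
exact: (fun_eval_miller_expN K_closed pK p_gt3 b0 hk r_prime rE pE emb hP hQ htheta onP onQ netW).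
Qed.
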